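(* For every abelian group $G$ and every natural number $n\ge 0$, the map $\sigma_n : K(G,n)\to \Omega K(G,n+1)$ is an equivalence.
   Context: We work in Homotopy Type Theory (as in the HoTT Book). $\Omega(A):=(\star_A=\star_A)$ is the loop space of a pointed type $(A,\star_A)$. The suspension $\Sigma A$ is the higher inductive type with points $\mathsf{north},\mathsf{south}$ and paths $\mathsf{merid}\,a:\mathsf{north}=\mathsf{south}$ for $a:A$. $\|A\|_n$ is the $n$-truncation, with canonical elements $|a|$. Eilenberg-MacLane spaces. For an abelian group $G$, the raw space $\widetilde K(G,1)$ is the higher inductive type generated by a point $\star$, a path $\mathsf{loop}_k\,g:\star=\star$ for every $g:G$, and for all $g_1,g_2:G$ a filler of the square with left side $\mathsf{refl}$, bottom $\mathsf{loop}_k\,g_1$, right side $\mathsf{loop}_k\,g_2$ and top $\mathsf{loop}_k(g_1+g_2)$ (i.e. a path $\mathsf{loop}_k\,g_1\cdot\mathsf{loop}_k\,g_2=\mathsf{loop}_k(g_1+g_2)$). For $n>1$, $\widetilde K(G,n):=\Sigma\,\widetilde K(G,n-1)$. The basepoint $0_k$ of $\widetilde K(G,n)$ is $\star$ if $n=1$ and $\mathsf{north}$ if $n>1$. Put $K(G,0):=G$ with basepoint $0_G$, and $K(G,n):=\|\widetilde K(G,n)\|_n$ with basepoint $|0_k|$ for $n\ge1$; all basepoints are written $0_k$. The map $\sigma_n$. For $n=0$, $\sigma_0(g):=\mathsf{loop}_k\,g$ (as a loop in $K(G,1)$, i.e. after applying $\mathsf{ap}_{|-|}$). For $n\ge 1$,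 $\sigma_n:K(G,n)\to\Omega K(G,n+1)$ is the map induced, by truncation elimination (its codomain is an $n$-type), from $\widetilde K(G,n)\to\Omega K(G,n+1)$, $x\mapsto \mathsf{ap}_{|-|}\big(\mathsf{merid}\,x\cdot(\mathsf{merid}\,0_k)^{-1}\big)$. *)

(* Defs.v *)
From Stdlib Require Import List Arith.
Import ListNotations.

(** Homotopy Type Theory in the style of the HoTT Book, as a formal system.

    HoTT is not identified with the ambient type theory: univalence contradicts
    proof irrelevance of [Prop], so a version with univalence as a hypothesis
    would be vacuous in the presence of the usual classical axioms.  A theorem of
    HoTT is a closed type [T] together with the existence of a term [t] such
    that [typing nil t T] is derivable. *)

(** * Raw syntax (de Bruijn indices) *)

Inductive cst : Type :=
| cSig | cPair | cSigInd
| cEmpty | cEmptyInd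
| cUnit | cStar | cUnitInd
| cSum | cInl | cInr | cSumInd
| cNat | cZero | cSuc | cNatInd
| cId | cRefl | cJ
| cFunext | cUa (k : nat)
| cSusp | cNorth | cSouth | cMerid | cSuspInd | cSuspIndMerid
| cEM | cBase | cLoop | cSquare | cEMInd | cEMIndPaths
| cTr | cTrIn | cTrLevel | cTrInd.

Inductive tm : Type :=
| Var (n : nat)
| Univ (i : nat)
| Pi (A B : tm)
| Lam (A b : tm)
| App (f a : tm)
| Cst (c : cst).

Definition up_ren (r : nat -> nat) (n : nat) : nat :=
  match n with 0 => 0 | S m => S (r m) end.

Fixpoint rename (r : nat -> nat) (t : tm) : tm :=
  match t with
  | Var n => Var (r n)
  | Univ i => Univ i
  | Pi A B => Pi (rename r A) (rename (up_ren r) B)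
  | Lam A b => Lam (rename r A) (rename (up_ren r) b)
  | App f a => App (rename r f) (rename r a)
  | Cst c => Cst c
  end.

Definition up_sub (s : nat -> tm) (n : nat) : tm :=
  match n with 0 => Var 0 | S m => rename S (s m) end.

Fixpoint subst (s : nat -> tm) (t : tm) : tm :=
  match t with
  | Var n => s n
  | Univ i => Univ i
  | Pi A B => Pi (subst s A) (subst (up_sub s) B)
  | Lam A b => Lam (subst s A) (subst (up_sub s) b)
  | App f a => App (subst s f) (subst s a)
  | Cst c => Cst c
  end.

Definition subst1 (a b : tm) : tm :=
  subst (fun n => match n with 0 => a | S m => Var m end) b.

Definition apps (f : tm) (l : list tm) : tm := fold_left App l f.

(** * Judgmental equality

    [beta], [eta] for functions, and the computation rules of the eliminators on
    point constructors.  As in pure type systems, the relation is on raw terms and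
    typing enters only in [ty_conv] below.  Parameters carried by a constructor (such as [A'] in
    [refl A' a]) are not compared with those of the eliminator, since typing
    forces them to agree. *)

Inductive conv : tm -> tm -> Prop :=
| conv_refl t : conv t t
| conv_sym t u : conv t u -> conv u t
| conv_trans t u v : conv t u -> conv u v -> conv t v
| conv_pi A A' B B' : conv A A' -> conv B B' -> conv (Pi A B) (Pi A' B')
| conv_lam A A' b b' : conv A A' -> conv b b' -> conv (Lam A b) (Lam A' b')
| conv_app f f' a a' : conv f f' -> conv a a' -> conv (App f a) (App f' a')
| conv_beta A b a : conv (App (Lam A b) a) (subst1 a b)
| conv_eta A f : conv (Lam A (App (rename S f) (Var 0))) f
| conv_sig A B C h A' B' a b :
    conv (apps (Cst cSigInd) [A; B; C; h; apps (Cst cPair) [A'; B'; a; b]])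
         (apps h [a; b])
| conv_unit C c :
    conv (apps (Cst cUnitInd) [C; c; Cst cStar]) c
| conv_inl A B C f g A' B' a :
    conv (apps (Cst cSumInd) [A; B; C; f; g; apps (Cst cInl) [A'; B'; a]])
         (App f a)
| conv_inr A B C f g A' B' b :
    conv (apps (Cst cSumInd) [A; B; C; f; g; apps (Cst cInr) [A'; B'; b]])
         (App g b)
| conv_zero C z s :
    conv (apps (Cst cNatInd) [C; z; s; Cst cZero]) z
| conv_suc C z s n :
    conv (apps (Cst cNatInd) [C; z; s; App (Cst cSuc) n])
         (apps s [n; apps (Cst cNatInd) [C; z; s; n]])
| conv_J A C c x y A' a :
    conv (apps (Cst cJ) [A; C; c; x; y; apps (Cst cRefl) [A'; a]]) (App c a)
| conv_north A C n s m A' :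
    conv (apps (Cst cSuspInd) [A; C; n; s; m; App (Cst cNorth) A']) n
| conv_south A C n s m A' :
    conv (apps (Cst cSuspInd) [A; C; n; s; m; App (Cst cSouth) A']) s
| conv_base G add C b l s G' add' :
    conv (apps (Cst cEMInd) [G; add; C; b; l; s; apps (Cst cBase) [G'; add']]) b
| conv_tr k A C h f k' A' a :
    conv (apps (Cst cTrInd) [k; A; C; h; f; apps (Cst cTrIn) [k'; A'; a]])
         (App f a).

(** * Notation for raw terms

    An [exp] maps the number of enclosing binders to a de Bruijn term; a bound
    variable introduced under [d] binders is the level [d], that is the index
    [d' - S d] where it is used under [d'] binders.  This allows Rocq binders to
    be used for the binders of the object language. *)

Definition exp : Type := nat -> tm.
Definition close (e : exp) : tm := e 0.

Definition bvar (d : nat) : exp := fun d' => Var (d' - S d).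
Definition pi (A : exp) (B : exp -> exp) : exp :=
  fun d => Pi (A d) (B (bvar d) (S d)).
Definition lam (A : exp) (b : exp -> exp) : exp :=
  fun d => Lam (A d) (b (bvar d) (S d)).
Definition app (f a : exp) : exp := fun d => App (f d) (a d).
Definition univ (i : nat) : exp := fun _ => Univ i.
Definition const (c : cst) : exp := fun _ => Cst c.

Declare Scope hott_scope.
Delimit Scope hott_scope with hott.
Bind Scope hott_scope with exp.
Notation "'Π' x : A , B" := (pi A (fun x => B))
  (at level 200, x name, A at level 200, B at level 200) : hott_scope.
Notation "'λ' x : A , b" := (lam A (fun x => b))
  (at level 200, x name, A at level 200, b at level 200) : hott_scope.
Notation "A ⇒ B" := (pi A (fun _ => B))
  (at level 99, right associativity, B at level 200) : hott_scope.
Notation "f · a" := (app f a) (at level 11, left associativity) : hott_scope.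
Open Scope hott_scope.

Definition Sig (A B : exp) : exp := const cSig · A · B.
Notation "'Σ' x : A , B" := (Sig A (lam A (fun x => B)))
  (at level 200, x name, A at level 200, B at level 200) : hott_scope.
Definition prod (A B : exp) : exp := Σ _ : A, B.
Definition pair (A B a b : exp) : exp := const cPair · A · B · a · b.

Definition Empty : exp := const cEmpty.
Definition Unit : exp := const cUnit.
Definition star : exp := const cStar.
Definition Sum (A B : exp) : exp := const cSum · A · B.
Definition inl (A B a : exp) : exp := const cInl · A · B · a.
Definition inr (A B b : exp) : exp := const cInr · A · B · b.

Definition Nat : exp := const cNat.
Definition zero : exp := const cZero.
Definition suc (n : exp) : exp := const cSuc · n.
Definition natind (C z s n : exp) : exp := const cNatInd · C · z · s · n.

Definition Id (A a b : exp) : exp := const cId · A · a · b.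
Definition refl (A a : exp) : exp := const cRefl · A · a.
Definition J (A C c x y p : exp) : exp := const cJ · A · C · c · x · y · p.

(** * Paths *)

Definition concat (A x y z p q : exp) : exp :=
  J A (λ x : A, λ y : A, λ _ : Id A x y, Π z : A, Id A y z ⇒ Id A x z)
      (λ x : A, λ z : A, λ q : Id A x z, q) x y p · z · q.

Definition inv (A x y p : exp) : exp :=
  J A (λ x : A, λ y : A, λ _ : Id A x y, Id A y x)
      (λ x : A, refl A x) x y p.

Definition ap (A B f x y p : exp) : exp :=
  J A (λ x : A, λ y : A, λ _ : Id A x y, Id B (f · x) (f · y))
      (λ x : A, refl B (f · x)) x y p.

Definition transport (A C x y p u : exp) : exp :=
  J A (λ x : A, λ y : A, λ _ : Id A x y, C · x ⇒ C · y)
      (λ x : A, λ u : C · x, u) x y p · u.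

(** The type of paths from [u : C x] to [v : C y] over [p : x = y]. *)
Definition IdOver (A C x y p u v : exp) : exp :=
  Id (C · y) (transport A C x y p u) v.

Definition apd (A C f x y p : exp) : exp :=
  J A (λ x : A, λ y : A, λ p : Id A x y, IdOver A C x y p (f · x) (f · y))
      (λ x : A, refl (C · x) (f · x)) x y p.

(** Concatenation of [a : u = v] over [p] and [b : v = w] over [q], a path over
    the concatenation of [p] and [q]. *)
Definition concatOver (A C x y z p q u v w a b : exp) : exp :=
  J A (λ x : A, λ y : A, λ p : Id A x y,
         Π q : Id A y z, Π u : C · x, Π v : C · y,
         IdOver A C x y p u v ⇒ IdOver A C y z q v w ⇒
         IdOver A C x z (concat A x y z p q) u w)
      (λ x : A, λ q : Id A x z, λ u : C · x, λ v : C · x,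
       λ a : Id (C · x) u v, λ b : IdOver A C x z q v w,
         concat (C · z) (transport A C x z q u) (transport A C x z q v) w
           (ap (C · x) (C · z) (λ u : C · x, transport A C x z q u) u v a) b)
      x y p · q · u · v · a · b.

(** The type of 2-paths from [a] to [b] over [r : p = q], where [a] and [b] are
    paths from [u] to [v] over [p] and [q] respectively. *)
Definition IdOver2 (A C x y u v p q r a b : exp) : exp :=
  IdOver (Id A x y) (λ p : Id A x y, IdOver A C x y p u v) p q r a b.

Definition apd_concat (A C f x y z p q : exp) : exp :=
  J A (λ x : A, λ y : A, λ p : Id A x y, Π q : Id A y z,
         Id (IdOver A C x z (concat A x y z p q) (f · x) (f · z))
            (concatOver A C x y z p q (f · x) (f · y) (f · z)
               (apd A C f x y p) (apd A C f y z q))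
            (apd A C f x z (concat A x y z p q)))
      (λ x : A, λ q : Id A x z,
         refl (IdOver A C x z q (f · x) (f · z)) (apd A C f x z q))
      x y p · q.

(** The action of a dependent function [f] on a 2-path
    [r : concat p q = p'], as a 2-path over [r]. *)
Definition apd2 (A C f x y z p q p' r : exp) : exp :=
  J (Id A x z)
    (λ s : Id A x z, λ t : Id A x z, λ r : Id (Id A x z) s t,
       Π e : IdOver A C x z s (f · x) (f · z),
       Id (IdOver A C x z s (f · x) (f · z)) e (apd A C f x z s) ⇒
       IdOver2 A C x z (f · x) (f · z) s t r e (apd A C f x z t))
    (λ s : Id A x z, λ e : IdOver A C x z s (f · x) (f · z),
     λ h : Id (IdOver A C x z s (f · x) (f · z)) e (apd A C f x z s), h)
    (concat A x y z p q) p' r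
  · concatOver A C x y z p q (f · x) (f · y) (f · z)
      (apd A C f x y p) (apd A C f y z q)
  · apd_concat A C f x y z p q.

(** * Equivalences and truncation levels *)

(** Bi-invertible maps. *)
Definition isequiv (A B f : exp) : exp :=
  prod (Σ g : B ⇒ A, Π y : B, Id B (f · (g · y)) y)
       (Σ h : B ⇒ A, Π x : A, Id A (h · (f · x)) x).

Definition equiv (A B : exp) : exp := Σ f : A ⇒ B, isequiv A B f.

Definition idequiv (A : exp) : exp :=
  pair (A ⇒ A) (λ f : A ⇒ A, isequiv A A f)
    (λ x : A, x)
    (pair (Σ g : A ⇒ A, Π y : A, Id A (g · y) y)
          (λ _ : (Σ g : A ⇒ A, Π y : A, Id A (g · y) y),
             Σ h : A ⇒ A, Π x : A, Id A (h · x) x)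
       (pair (A ⇒ A) (λ g : A ⇒ A, Π y : A, Id A (g · y) y)
          (λ x : A, x) (λ y : A, refl A y))
       (pair (A ⇒ A) (λ h : A ⇒ A, Π x : A, Id A (h · x) x)
          (λ x : A, x) (λ x : A, refl A x))).

Definition idtoequiv (i : nat) (A B p : exp) : exp :=
  J (univ i)
    (λ A : univ i, λ B : univ i, λ _ : Id (univ i) A B, equiv A B)
    (λ A : univ i, idequiv A) A B p.

Definition happly (A B f g p : exp) : exp :=
  J (Π x : A, B · x)
    (λ f : (Π x : A, B · x), λ g : (Π x : A, B · x),
     λ _ : Id (Π x : A, B · x) f g, Π x : A, Id (B · x) (f · x) (g · x))
    (λ f : (Π x : A, B · x), λ x : A, refl (B · x) (f · x)) f g p.

Definition isSet (A : exp) : exp :=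
  Π x : A, Π y : A, Π p : Id A x y, Π q : Id A x y, Id (Id A x y) p q.

Definition isContr (A : exp) : exp := Σ x : A, Π y : A, Id A x y.

(** Truncation levels are shifted by two: for [A : univ i], [istrunc i k A] says
    that [A] is a (k-2)-type. *)
Definition istrunc (i : nat) (k A : exp) : exp :=
  natind (λ _ : Nat, univ i ⇒ univ i)
    (λ A : univ i, isContr A)
    (λ _ : Nat, λ P : univ i ⇒ univ i, λ A : univ i,
       Π x : A, Π y : A, P · Id A x y)
    k · A.

(** * Higher inductive types *)

Definition Susp (A : exp) : exp := const cSusp · A.
Definition north (A : exp) : exp := const cNorth · A.
Definition south (A : exp) : exp := const cSouth · A.
Definition merid (A a : exp) : exp := const cMerid · A · a.

(** [EM1 G add] is the raw Eilenberg-MacLane space K~(G,1); its constructors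
    only mention the carrier and the addition of [G]. *)
Definition EM1 (G add : exp) : exp := const cEM · G · add.
Definition base (G add : exp) : exp := const cBase · G · add.
Definition loop (G add g : exp) : exp := const cLoop · G · add · g.
Definition square (G add g h : exp) : exp := const cSquare · G · add · g · h.

(** The data over [loop] and over [square] in the induction principle. *)
Definition EM_loops (G add C b : exp) : exp :=
  Π g : G,
    IdOver (EM1 G add) C (base G add) (base G add) (loop G add g) b b.
Definition EM_squares (G add C b l : exp) : exp :=
  let K := EM1 G add in
  let pt := base G add in
  let lp := loop G add in
  Π g : G, Π h : G,
    IdOver2 K C pt pt b b
      (concat K pt pt pt (lp g) (lp h)) (lp (add · g · h))
      (square G add g h)
      (concatOver K C pt pt pt (lp g) (lp h) b b b (l · g) (l · h))
      (l · (add · g · h)).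

(** [Tr k A] is the (k-2)-truncation of [A], given by the constructors [tr] and
    [tr_level] (it is a (k-2)-type) and by induction into families of
    (k-2)-types. *)
Definition Tr (k A : exp) : exp := const cTr · k · A.
Definition tr (k A a : exp) : exp := const cTrIn · k · A · a.
Definition tr_level (k A : exp) : exp := const cTrLevel · k · A.
Definition trind (k A C h f x : exp) : exp :=
  const cTrInd · k · A · C · h · f · x.

(** * Types of the constants

    Constants are available at all universe levels: [i] is the level of the
    parameters and [j] the level of the family in an elimination rule. *)

Definition cst_type (i j : nat) (c : cst) : exp :=
  match c with
  | cSig => Π A : univ i, (A ⇒ univ i) ⇒ univ i
  | cPair => Π A : univ i, Π B : A ⇒ univ i, Π a : A, B · a ⇒ Sig A B
  | cSigInd =>
      Π A : univ i, Π B : A ⇒ univ i, Π C : Sig A B ⇒ univ j,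
      (Π a : A, Π b : B · a, C · pair A B a b) ⇒ Π p : Sig A B, C · p
  | cEmpty => univ i
  | cEmptyInd => Π C : Empty ⇒ univ j, Π x : Empty, C · x
  | cUnit => univ i
  | cStar => Unit
  | cUnitInd => Π C : Unit ⇒ univ j, C · star ⇒ Π x : Unit, C · x
  | cSum => univ i ⇒ univ i ⇒ univ i
  | cInl => Π A : univ i, Π B : univ i, A ⇒ Sum A B
  | cInr => Π A : univ i, Π B : univ i, B ⇒ Sum A B
  | cSumInd =>
      Π A : univ i, Π B : univ i, Π C : Sum A B ⇒ univ j,
      (Π a : A, C · inl A B a) ⇒ (Π b : B, C · inr A B b) ⇒
      Π x : Sum A B, C · x
  | cNat => univ i
  | cZero => Nat
  | cSuc => Nat ⇒ Nat
  | cNatInd =>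
      Π C : Nat ⇒ univ j,
      C · zero ⇒ (Π n : Nat, C · n ⇒ C · suc n) ⇒ Π n : Nat, C · n
  | cId => Π A : univ i, A ⇒ A ⇒ univ i
  | cRefl => Π A : univ i, Π a : A, Id A a a
  | cJ =>
      Π A : univ i, Π C : (Π x : A, Π y : A, Id A x y ⇒ univ j),
      (Π x : A, C · x · x · refl A x) ⇒
      Π x : A, Π y : A, Π p : Id A x y, C · x · y · p
  | cFunext =>
      Π A : univ i, Π B : A ⇒ univ i,
      Π f : (Π x : A, B · x), Π g : (Π x : A, B · x),
      isequiv (Id (Π x : A, B · x) f g) (Π x : A, Id (B · x) (f · x) (g · x))
        (λ p : Id (Π x : A, B · x) f g, happly A B f g p)
  | cUa k =>
      Π A : univ k, Π B : univ k,
      isequiv (Id (univ k) A B) (equiv A B)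
        (λ p : Id (univ k) A B, idtoequiv k A B p)
  | cSusp => univ i ⇒ univ i
  | cNorth => Π A : univ i, Susp A
  | cSouth => Π A : univ i, Susp A
  | cMerid => Π A : univ i, A ⇒ Id (Susp A) (north A) (south A)
  | cSuspInd =>
      Π A : univ i, Π C : Susp A ⇒ univ j,
      Π n : C · north A, Π s : C · south A,
      (Π a : A, IdOver (Susp A) C (north A) (south A) (merid A a) n s) ⇒
      Π x : Susp A, C · x
  | cSuspIndMerid =>
      Π A : univ i, Π C : Susp A ⇒ univ j,
      Π n : C · north A, Π s : C · south A,
      Π m : (Π a : A,
               IdOver (Susp A) C (north A) (south A) (merid A a) n s),
      Π a : A,
      Id (IdOver (Susp A) C (north A) (south A) (merid A a) n s)
        (apd (Susp A) C (const cSuspInd · A · C · n · s · m)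
           (north A) (south A) (merid A a))
        (m · a)
  | cEM => Π G : univ i, (G ⇒ G ⇒ G) ⇒ univ i
  | cBase => Π G : univ i, Π add : G ⇒ G ⇒ G, EM1 G add
  | cLoop =>
      Π G : univ i, Π add : G ⇒ G ⇒ G,
      G ⇒ Id (EM1 G add) (base G add) (base G add)
  | cSquare =>
      Π G : univ i, Π add : G ⇒ G ⇒ G, Π g : G, Π h : G,
      Id (Id (EM1 G add) (base G add) (base G add))
        (concat (EM1 G add) (base G add) (base G add) (base G add)
           (loop G add g) (loop G add h))
        (loop G add (add · g · h))
  | cEMInd =>
      Π G : univ i, Π add : G ⇒ G ⇒ G, Π C : EM1 G add ⇒ univ j,
      Π b : C · base G add, Π l : EM_loops G add C b,
      EM_squares G add C b l ⇒ Π x : EM1 G add, C · x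
  | cEMIndPaths =>
      (* The computation rules on [loop] and [square] jointly: the action of the
         eliminator on them, as a pair, is the pair [l], [s]. *)
      Π G : univ i, Π add : G ⇒ G ⇒ G, Π C : EM1 G add ⇒ univ j,
      Π b : C · base G add, Π l : EM_loops G add C b,
      Π s : EM_squares G add C b l,
      let K := EM1 G add in
      let pt := base G add in
      let lp := loop G add in
      let f := const cEMInd · G · add · C · b · l · s in
      let L := EM_loops G add C b in
      let S := λ l : EM_loops G add C b, EM_squares G add C b l in
      Id (Sig L S)
        (pair L S
           (λ g : G, apd K C f pt pt (lp g))
           (λ g : G, λ h : G,
              apd2 K C f pt pt pt (lp g) (lp h) (lp (add · g · h))
                (square G add g h)))
        (pair L S l s)
  | cTr => Nat ⇒ univ i ⇒ univ i
  | cTrIn => Π k : Nat, Π A : univ i, A ⇒ Tr k A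
  | cTrLevel => Π k : Nat, Π A : univ i, istrunc i k (Tr k A)
  | cTrInd =>
      Π k : Nat, Π A : univ i, Π C : Tr k A ⇒ univ j,
      (Π x : Tr k A, istrunc j k (C · x)) ⇒
      (Π a : A, C · tr k A a) ⇒ Π x : Tr k A, C · x
  end.

(** * Typing

    Contexts list the most recent variable first.  [typing] derives no
    well-formedness of contexts, but every binder is entered with a type that
    has been checked. *)

Inductive typing : list tm -> tm -> tm -> Prop :=
| ty_var G n A :
    nth_error G n = Some A -> typing G (Var n) (rename (Nat.add (S n)) A)
| ty_univ G i : typing G (Univ i) (Univ (S i))
| ty_cumul G A i : typing G A (Univ i) -> typing G A (Univ (S i))
| ty_pi G A B i :
    typing G A (Univ i) -> typing (A :: G) B (Univ i) ->
    typing G (Pi A B) (Univ i)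
| ty_lam G A B b i :
    typing G A (Univ i) -> typing (A :: G) b B -> typing G (Lam A b) (Pi A B)
| ty_app G A B f a :
    typing G f (Pi A B) -> typing G a A -> typing G (App f a) (subst1 a B)
| ty_cst G c i j : typing G (Cst c) (close (cst_type i j c))
| ty_conv G t A B i :
    typing G t A -> conv A B -> typing G B (Univ i) -> typing G t B.

(** * Eilenberg-MacLane spaces *)

Definition forall_abgroup (i : nat) (P : exp -> exp -> exp -> exp) : exp :=
  Π G : univ i, isSet G ⇒
  Π add : G ⇒ G ⇒ G, Π z : G, Π neg : G ⇒ G,
  (Π x : G, Π y : G, Π w : G,
     Id G (add · x · (add · y · w)) (add · (add · x · y) · w)) ⇒
  (Π x : G, Id G (add · x · z) x) ⇒
  (Π x : G, Id G (add · x · (neg · x)) z) ⇒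
  (Π x : G, Π y : G, Id G (add · x · y) (add · y · x)) ⇒
  P G add z.

Definition Loops (A a : exp) : exp := Id A a a.

(** [rawK i G add m] is K~(G,m+1), for [G : univ i]. *)
Definition rawK (i : nat) (G add m : exp) : exp :=
  natind (λ _ : Nat, univ i) (EM1 G add)
    (λ _ : Nat, λ X : univ i, Susp X) m.

Definition rawK_pt (i : nat) (G add m : exp) : exp :=
  natind (λ m : Nat, rawK i G add m) (base G add)
    (λ m : Nat, λ _ : rawK i G add m, north (rawK i G add m)) m.

(** The index of [Tr] for (m+1)-truncation. *)
Definition lev (m : exp) : exp := suc (suc (suc m)).

Definition K (i : nat) (G add n : exp) : exp :=
  natind (λ _ : Nat, univ i) G
    (λ m : Nat, λ _ : univ i, Tr (lev m) (rawK i G add m)) n.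

Definition K_pt (i : nat) (G add z n : exp) : exp :=
  natind (λ n : Nat, K i G add n) z
    (λ m : Nat, λ _ : K i G add m,
       tr (lev m) (rawK i G add m) (rawK_pt i G add m)) n.

Definition LoopK (i : nat) (G add z n : exp) : exp :=
  Loops (K i G add (suc n)) (K_pt i G add z (suc n)).

(** The action on paths of the canonical map from K~(G,m+1) to K(G,m+1). *)
Definition ap_tr (i : nat) (G add m x y p : exp) : exp :=
  ap (rawK i G add m) (K i G add (suc m))
    (λ x : rawK i G add m, tr (lev m) (rawK i G add m) x) x y p.

(** The map [x |-> ap_tr (merid x . (merid 0)^-1)] from K~(G,m+1) to the loop
    space of K(G,m+2). *)
Definition raw_sigma (i : nat) (G add m x : exp) : exp :=
  let X := rawK i G add m in
  ap_tr i G add (suc m) (north X) (north X)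
    (concat (Susp X) (north X) (south X) (north X)
       (merid X x)
       (inv (Susp X) (north X) (south X) (merid X (rawK_pt i G add m)))).

(** The loop space of K(G,m+2), an (m+2)-type, is an (m+1)-type because
    [istrunc] unfolds judgmentally at a successor. *)
Definition LoopK_level (i : nat) (G add z m : exp) : exp :=
  tr_level (lev (suc m)) (rawK i G add (suc m))
  · K_pt i G add z (suc (suc m)) · K_pt i G add z (suc (suc m)).

Definition sigma (i : nat) (G add z n : exp) : exp :=
  natind (λ n : Nat, K i G add n ⇒ LoopK i G add z n)
    (λ g : G, ap_tr i G add zero (base G add) (base G add) (loop G add g))
    (λ m : Nat, λ _ : (K i G add m ⇒ LoopK i G add z m),
     λ x : K i G add (suc m),
       trind (lev m) (rawK i G add m)
         (λ _ : K i G add (suc m), LoopK i G add z (suc m))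
         (λ _ : K i G add (suc m), LoopK_level i G add z m)
         (λ a : rawK i G add m, raw_sigma i G add m a)
         x)
    n.

(* Main.v *)
From Stdlib Require Import List Arith Lia Bool.
Require Import Defs.
Import ListNotations.

(** The map [sigma] is inverted by an encode-decode argument. Over K(G,n+1) one
    defines a family of n-types with fibre K(G,n) at the base point. By
    univalence it suffices to give an auto-equivalence of K(G,n) for each
    generating path, and one takes translation by the corresponding element.
    Transporting 0 along [sigma u] then yields [u], so [sigma] has the left
    inverse [p |-> transport p 0]. It is also a right inverse as soon as [sigma]
    extends to a section [decode] of [x |-> (code x -> base = x)], by path
    induction ([encode_decode]). On the path constructors, such an extension
    amounts to the identity sigma(u) . (path of a) = sigma(u + a), up to a fixed
    path. In degree 0 this is the [square] constructor.

    In degree n = m+1 the translations have to be constructed. The raw space is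
    m-connected, in the sense that a family of (m-1)-types over it has a section
    through any point of the base fibre ([conn]). Consequently the sections of a
    family of m-types with a given value at the base point form a proposition
    ([isprop_extensions]), and for (m+1)-types they form a set
    ([isset_extensions]). Translation by [a] is sought among the maps [f] with
    [f 0 = |a|]. These form a set for each [a], so by connectedness it is enough
    to give one for [a = 0], the canonical map ([multiplication]). For m = 0
    sets are beyond the reach of connectedness, and one has to move the canonical
    map around each loop; this is where commutativity of G enters
    ([loop_homotopy]). A translation is an equivalence because the one by 0 is.
    The additivity of [sigma] in the variable [x], with a prescribed value at
    [x = 0], is again a proposition depending on [a], which only has to be
    checked at [a = 0] ([sigma_hom]).

    A derivation of this in the formal system is too long to be written by hand.
    The argument is therefore carried out with Rocq terms in which every
    constant of the formal system has a counterpart, and these terms are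
    reified. The result is processed by a type checker that is proved sound for
    the typing rules ([proves_sound]). The checker works with G in the lowest
    universe; since the rules are uniform in the universe levels, a derivation
    can be raised to any level ([typing_raise]). *)

(** * Metatheory of the formal system *)

Module Meta.

Lemma up_ren_ext r r' : (forall n, r n = r' n) -> forall n, up_ren r n = up_ren r' n.
Proof. intros H [|n]; cbn; congruence. Qed.

Lemma rename_ext t : forall r r', (forall n, r n = r' n) -> rename r t = rename r' t.
Proof.
  induction t; intros r r' H; cbn; f_equal; auto using up_ren_ext.
Qed.

Lemma up_sub_ext s s' : (forall n, s n = s' n) -> forall n, up_sub s n = up_sub s' n.
Proof. intros H [|n]; cbn; congruence. Qed.

Lemma subst_ext t : forall s s', (forall n, s n = s' n) -> subst s t = subst s' t.
Proof.
  induction t; intros s s' H; cbn; f_equal; auto using up_sub_ext.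
Qed.

Lemma rename_rename t : forall r r',
  rename r (rename r' t) = rename (fun n => r (r' n)) t.
Proof.
  induction t; intros r r'; cbn; f_equal; auto.
  - rewrite IHt2; apply rename_ext; intros [|n]; reflexivity.
  - rewrite IHt2; apply rename_ext; intros [|n]; reflexivity.
Qed.

Lemma subst_rename t : forall s r,
  subst s (rename r t) = subst (fun n => s (r n)) t.
Proof.
  induction t; intros s r; cbn; f_equal; auto.
  - rewrite IHt2; apply subst_ext; intros [|n]; reflexivity.
  - rewrite IHt2; apply subst_ext; intros [|n]; reflexivity.
Qed.

Lemma rename_subst t : forall r s,
  rename r (subst s t) = subst (fun n => rename r (s n)) t.
Proof.
  induction t; intros r s; cbn; f_equal; auto.
  - rewrite IHt2; apply subst_ext; intros [|n]; cbn; auto.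
    rewrite !rename_rename; reflexivity.
  - rewrite IHt2; apply subst_ext; intros [|n]; cbn; auto.
    rewrite !rename_rename; reflexivity.
Qed.

Lemma subst_subst t : forall s s',
  subst s (subst s' t) = subst (fun n => subst s (s' n)) t.
Proof.
  induction t; intros s s'; cbn; f_equal; auto.
  - rewrite IHt2; apply subst_ext; intros [|n]; cbn; auto.
    rewrite subst_rename, rename_subst; reflexivity.
  - rewrite IHt2; apply subst_ext; intros [|n]; cbn; auto.
    rewrite subst_rename, rename_subst; reflexivity.
Qed.

Lemma subst_Var t : forall s, (forall n, s n = Var n) -> subst s t = t.
Proof.
  induction t; intros s H; cbn; f_equal; auto.
  - apply IHt2; intros [|n]; cbn; rewrite ?H; reflexivity.
  - apply IHt2; intros [|n]; cbn; rewrite ?H; reflexivity.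
Qed.

Lemma rename_as_subst t r : rename r t = subst (fun n => Var (r n)) t.
Proof.
  rewrite <- (subst_Var (rename r t) Var) by reflexivity.
  apply subst_rename.
Qed.

Lemma subst_subst1 s a b :
  subst s (subst1 a b) = subst1 (subst s a) (subst (up_sub s) b).
Proof.
  unfold subst1; rewrite !subst_subst; apply subst_ext; intros [|n]; cbn; auto.
  rewrite subst_rename, subst_Var; reflexivity.
Qed.

Lemma rename_subst1 r a b :
  rename r (subst1 a b) = subst1 (rename r a) (rename (up_ren r) b).
Proof.
  unfold subst1; rewrite rename_subst, subst_rename; apply subst_ext.
  intros [|n]; reflexivity.
Qed.

Lemma subst1_rename_S a t : subst1 a (rename S t) = t.
Proof. unfold subst1; rewrite subst_rename; apply subst_Var; reflexivity. Qed.

(** ** Closed terms *)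

Fixpoint closed_at (k : nat) (t : tm) : bool :=
  match t with
  | Var n => n <? k
  | Univ _ | Cst _ => true
  | Pi A B => closed_at k A && closed_at (S k) B
  | Lam A b => closed_at k A && closed_at (S k) b
  | App f a => closed_at k f && closed_at k a
  end.

Lemma closed_at_subst t : forall k s,
  closed_at k t = true -> (forall n, n < k -> s n = Var n) -> subst s t = t.
Proof.
  induction t; intros k s Hc H; cbn -[Nat.ltb] in *; auto;
    rewrite ?andb_true_iff, ?Nat.ltb_lt in Hc; auto;
    destruct Hc; f_equal; eauto;
    eapply IHt2; eauto; intros [|n] Hn; cbn; auto;
    rewrite H by lia; reflexivity.
Qed.

Lemma closed_subst t s : closed_at 0 t = true -> subst s t = t.
Proof. intros H; eapply closed_at_subst; eauto; lia. Qed.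

Lemma closed_rename t r : closed_at 0 t = true -> rename r t = t.
Proof. intros H; rewrite rename_as_subst; apply closed_subst; auto. Qed.

Lemma typing_closed_at G t A : typing G t A -> closed_at (length G) t = true.
Proof.
  induction 1; cbn in *; auto; rewrite ?andb_true_iff; auto.
  apply Nat.ltb_lt, nth_error_Some; congruence.
Qed.

Lemma cst_type_closed i j c : closed_at 0 (close (cst_type i j c)) = true.
Proof. destruct c; reflexivity. Qed.

(** ** Conversion *)

Ltac conv_congr :=
  first [ apply conv_refl | apply conv_pi | apply conv_lam | apply conv_sig
        | apply conv_unit | apply conv_inl | apply conv_inr
        | apply conv_zero | apply conv_suc | apply conv_J | apply conv_north
        | apply conv_south | apply conv_base | apply conv_tr
        | apply conv_app ]; auto.

Lemma conv_subst t u : conv t u -> forall s, conv (subst s t) (subst s u).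
Proof.
  induction 1; intros s0; cbn; try solve [conv_congr].
  - apply conv_sym; auto.
  - eapply conv_trans; eauto.
  - rewrite subst_subst1; apply conv_beta.
  - rewrite subst_rename.
    erewrite (subst_ext f) by (intros n; cbn; reflexivity).
    rewrite <- rename_subst. apply conv_eta.
Qed.

Lemma conv_rename t u r : conv t u -> conv (rename r t) (rename r u).
Proof. intros H; rewrite !rename_as_subst; apply conv_subst; auto. Qed.

(** Eta for raw terms makes the domain annotation of an abstraction irrelevant:
    [Lam A ((Lam B b) x)] reduces to both sides. *)
Lemma conv_lam_dom A B b : conv (Lam A b) (Lam B b).
Proof.
  eapply conv_trans; [|apply (conv_eta A (Lam B b))].
  apply conv_lam; [apply conv_refl|].
  apply conv_sym. cbn.
  eapply conv_trans; [apply conv_beta|].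
  unfold subst1; rewrite subst_rename, subst_Var; [apply conv_refl|].
  intros [|n]; reflexivity.
Qed.

Lemma conv_apps f g l l' :
  conv f g -> Forall2 conv l l' -> conv (apps f l) (apps g l').
Proof.
  intros H HF; revert f g H; induction HF; intros f g H'; cbn; auto.
  apply IHHF; apply conv_app; auto.
Qed.

(** ** Weakening and substitution *)

Definition ren_ok (r : nat -> nat) (G D : list tm) : Prop :=
  forall n A, nth_error G n = Some A -> exists A', nth_error D (r n) = Some A' /\
    rename (Nat.add (S (r n))) A' = rename r (rename (Nat.add (S n)) A).

Lemma ren_ok_up r G D A :
  ren_ok r G D -> ren_ok (up_ren r) (A :: G) (rename r A :: D).
Proof.
  intros H [|n] B E; cbn in *.
  - injection E as <-. eexists; split; [reflexivity|].
    rewrite !rename_rename. apply rename_ext; reflexivity.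
  - destruct (H _ _ E) as (A' & E' & e). exists A'; split; auto.
    transitivity (rename S (rename (Nat.add (S (r n))) A')).
    { rewrite rename_rename; reflexivity. }
    rewrite e, !rename_rename; apply rename_ext; reflexivity.
Qed.

Lemma typing_rename G t A : typing G t A ->
  forall r D, ren_ok r G D -> typing D (rename r t) (rename r A).
Proof.
  induction 1; intros r D HR; cbn.
  - destruct (HR _ _ H) as (A' & E & e).
    pose proof (ty_var D (r n) A' E) as V. rewrite e in V. exact V.
  - apply ty_univ.
  - apply ty_cumul, IHtyping; auto.
  - apply ty_pi; [apply IHtyping1 | apply IHtyping2]; auto using ren_ok_up.
  - eapply ty_lam; [apply IHtyping1 | apply IHtyping2]; auto using ren_ok_up.
  - rewrite rename_subst1. eapply ty_app; [apply IHtyping1 | apply IHtyping2]; auto.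
  - rewrite closed_rename by apply cst_type_closed. apply ty_cst.
  - eapply ty_conv; [apply IHtyping1 | apply conv_rename | apply IHtyping2]; eauto.
Qed.

Lemma ren_ok_S G A : ren_ok S G (A :: G).
Proof.
  intros n B E; exists B; split; auto. rewrite rename_rename; reflexivity.
Qed.

Lemma typing_weaken G t A B : typing G t A -> typing (B :: G) (rename S t) (rename S A).
Proof. intros H; eapply typing_rename; eauto using ren_ok_S. Qed.

Lemma typing_closed_weaken G t A : typing nil t A -> closed_at 0 A = true -> typing G t A.
Proof.
  intros H HA. pose proof (typing_closed_at _ _ _ H) as Ht; cbn in Ht.
  rewrite <- (closed_rename t id Ht), <- (closed_rename A id HA).
  eapply typing_rename; eauto. intros [|n] B E; discriminate.
Qed.

Definition sub_ok (s : nat -> tm) (G D : list tm) : Prop :=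
  forall n A, nth_error G n = Some A ->
    typing D (s n) (subst s (rename (Nat.add (S n)) A)).

Lemma sub_ok_up s G D A :
  sub_ok s G D -> sub_ok (up_sub s) (A :: G) (subst s A :: D).
Proof.
  intros H [|n] B E; cbn in E.
  - injection E as <-.
    pose proof (ty_var (subst s A :: D) 0 _ eq_refl) as V.
    rewrite rename_subst in V. rewrite subst_rename. exact V.
  - pose proof (typing_weaken _ _ _ (subst s A) (H _ _ E)) as V.
    rewrite subst_rename, rename_subst in V. rewrite subst_rename. exact V.
Qed.

Lemma typing_subst G t A : typing G t A ->
  forall s D, sub_ok s G D -> typing D (subst s t) (subst s A).
Proof.
  induction 1; intros s D HS; cbn.
  - apply HS; auto.
  - apply ty_univ.
  - apply ty_cumul, IHtyping; auto.
  - apply ty_pi; [apply IHtyping1 | apply IHtyping2]; auto using sub_ok_up.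
  - eapply ty_lam; [apply IHtyping1 | apply IHtyping2]; auto using sub_ok_up.
  - rewrite subst_subst1. eapply ty_app; [apply IHtyping1 | apply IHtyping2]; auto.
  - rewrite closed_subst by apply cst_type_closed. apply ty_cst.
  - eapply ty_conv; [apply IHtyping1 | apply conv_subst | apply IHtyping2]; eauto.
Qed.

Lemma typing_subst1 G A b B a :
  typing (A :: G) b B -> typing G a A -> typing G (subst1 a b) (subst1 a B).
Proof.
  intros Hb Ha. eapply typing_subst; eauto. intros [|n] C E; cbn in *.
  - injection E as <-. rewrite subst_rename, subst_Var; auto.
  - rewrite subst_rename.
    erewrite (subst_ext C); [rewrite <- rename_as_subst|reflexivity].
    apply ty_var; auto.
Qed.

(** Substituting [Var 0], retyped by conversion, for itself. *)
Lemma typing_conv_ctx G A A' k l t B :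
  typing G A (Univ k) -> typing G A' (Univ l) -> conv A' A ->
  typing (A :: G) t B -> typing (A' :: G) t B.
Proof.
  intros HA HA' Hc H.
  rewrite <- (subst_Var t Var), <- (subst_Var B Var) by reflexivity.
  eapply typing_subst; eauto. intros [|n] C E; cbn in E; rewrite subst_Var by reflexivity.
  - injection E as <-. eapply ty_conv.
    + apply ty_var; reflexivity.
    + apply conv_rename; eauto.
    + exact (typing_weaken _ _ _ A' HA).
  - apply ty_var; auto.
Qed.

(** ** Universes and inversion *)

Lemma typing_cumul_le G A i j : i <= j -> typing G A (Univ i) -> typing G A (Univ j).
Proof. induction 1; auto using ty_cumul. Qed.

Lemma typing_Pi_inv G A B T : typing G (Pi A B) T ->
  exists i, typing G A (Univ i) /\ typing (A :: G) B (Univ i).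
Proof.
  remember (Pi A B) as P eqn:E. intros H; revert A B E.
  induction H; intros A0 B0 E; try discriminate; eauto.
  injection E as <- <-; eauto.
Qed.

(** ** Raising all universe levels *)

Fixpoint raise (d : nat) (t : tm) : tm :=
  match t with
  | Var n => Var n
  | Univ i => Univ (i + d)
  | Pi A B => Pi (raise d A) (raise d B)
  | Lam A b => Lam (raise d A) (raise d b)
  | App f a => App (raise d f) (raise d a)
  | Cst (cUa k) => Cst (cUa (k + d))
  | Cst c => Cst c
  end.

Definition raise_cst (d : nat) (c : cst) : cst :=
  match c with cUa k => cUa (k + d) | _ => c end.

Lemma raise_Cst d c : raise d (Cst c) = Cst (raise_cst d c).
Proof. destruct c; reflexivity. Qed.

Lemma raise_rename d t : forall r, raise d (rename r t) = rename r (raise d t).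
Proof. induction t; intros r; cbn; f_equal; auto. destruct c; reflexivity. Qed.

Lemma raise_subst d t : forall s,
  raise d (subst s t) = subst (fun n => raise d (s n)) (raise d t).
Proof.
  induction t; intros s; cbn; f_equal; auto.
  - rewrite IHt2; apply subst_ext; intros [|n]; cbn; auto using raise_rename.
  - rewrite IHt2; apply subst_ext; intros [|n]; cbn; auto using raise_rename.
  - destruct c; reflexivity.
Qed.

Lemma raise_subst1 d a b : raise d (subst1 a b) = subst1 (raise d a) (raise d b).
Proof.
  unfold subst1; rewrite raise_subst; apply subst_ext; intros [|n]; reflexivity.
Qed.

Lemma raise_conv d t u : conv t u -> conv (raise d t) (raise d u).
Proof.
  induction 1; cbn; try solve [conv_congr].
  - apply conv_sym; auto.
  - eapply conv_trans; eauto.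
  - rewrite raise_subst1; apply conv_beta.
  - rewrite raise_rename; apply conv_eta.
Qed.

Lemma raise_cst_type d i j c :
  raise d (close (cst_type i j c)) = close (cst_type (i + d) (j + d) (raise_cst d c)).
Proof. destruct c; reflexivity. Qed.

(** No rule singles out a universe, so all levels of a derivation can be raised
    by the same amount. *)
Lemma typing_raise d G t A :
  typing G t A -> typing (map (raise d) G) (raise d t) (raise d A).
Proof.
  induction 1; cbn -[raise] in *.
  - rewrite raise_rename. apply ty_var. rewrite nth_error_map, H; reflexivity.
  - apply ty_univ.
  - apply ty_cumul; auto.
  - cbn in *; apply ty_pi; auto.
  - cbn in *; eapply ty_lam; eauto.
  - rewrite raise_subst1. cbn in *. eapply ty_app; eauto.
  - rewrite raise_Cst, raise_cst_type. apply ty_cst.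
  - cbn in *; eapply ty_conv; eauto using raise_conv.
Qed.

End Meta.

Import Meta.

(** * A verified type checker *)

Module Checker.

(** Terms of the checker. They have constants for previously checked definitions
    ([sGlob]), which are unfolded on demand only; this keeps types small. A
    constant carries the levels [i] and [j] at which its type is taken. *)
Inductive src : Type :=
| sVar (n : nat)
| sUniv (i : nat)
| sPi (A B : src)
| sLam (A b : src)
| sApp (f a : src)
| sCst (c : cst) (i j : nat)
| sGlob (n : nat).

(** A conjunction that does not evaluate its second argument when the first one
    is false, under call-by-value reduction. *)
Notation "a '&&&' b" := (if a then b else false) (at level 40, left associativity).

Lemma and_true_iff (a b : bool) : a &&& b = true <-> a = true /\ b = true.
Proof. destruct a; intuition discriminate. Qed.

Definition sapps (f : src) (l : list src) : src := fold_left sApp l f.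

Fixpoint slift (n k : nat) (t : src) : src :=
  match t with
  | sVar m => if m <? k then t else sVar (n + m)
  | sUniv _ | sCst _ _ _ | sGlob _ => t
  | sPi A B => sPi (slift n k A) (slift n (S k) B)
  | sLam A b => sLam (slift n k A) (slift n (S k) b)
  | sApp f a => sApp (slift n k f) (slift n k a)
  end.

Fixpoint ssub (k : nat) (a t : src) : src :=
  match t with
  | sVar m => match Nat.compare m k with
              | Lt => t
              | Eq => slift k 0 a
              | Gt => sVar (pred m)
              end
  | sUniv _ | sCst _ _ _ | sGlob _ => t
  | sPi A B => sPi (ssub k a A) (ssub (S k) a B)
  | sLam A b => sLam (ssub k a A) (ssub (S k) a b)
  | sApp f b => sApp (ssub k a f) (ssub k a b)
  end.

(** An injective code, which makes the comparison of constants linear in size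
    instead of quadratic. *)
Definition cst_code (c : cst) : nat * nat :=
  match c with
  | cSig => (0, 0) | cPair => (1, 0) | cSigInd => (2, 0)
  | cEmpty => (3, 0) | cEmptyInd => (4, 0)
  | cUnit => (5, 0) | cStar => (6, 0) | cUnitInd => (7, 0)
  | cSum => (8, 0) | cInl => (9, 0) | cInr => (10, 0) | cSumInd => (11, 0)
  | cNat => (12, 0) | cZero => (13, 0) | cSuc => (14, 0) | cNatInd => (15, 0)
  | cId => (16, 0) | cRefl => (17, 0) | cJ => (18, 0)
  | cFunext => (19, 0) | cUa k => (20, k)
  | cSusp => (21, 0) | cNorth => (22, 0) | cSouth => (23, 0)
  | cMerid => (24, 0) | cSuspInd => (25, 0) | cSuspIndMerid => (26, 0)
  | cEM => (27, 0) | cBase => (28, 0) | cLoop => (29, 0)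
  | cSquare => (30, 0) | cEMInd => (31, 0) | cEMIndPaths => (32, 0)
  | cTr => (33, 0) | cTrIn => (34, 0) | cTrLevel => (35, 0) | cTrInd => (36, 0)
  end.

Definition cst_eqb (c d : cst) : bool :=
  let (m, k) := cst_code c in
  let (n, l) := cst_code d in (m =? n) && (k =? l).

Lemma cst_eqb_eq c d : cst_eqb c d = true -> c = d.
Proof.
  unfold cst_eqb; destruct c, d; cbn; try discriminate; auto.
  intros E; apply Nat.eqb_eq in E; congruence.
Qed.

Fixpoint seqb (t u : src) : bool :=
  match t, u with
  | sVar m, sVar n => m =? n
  | sUniv i, sUniv j => i =? j
  | sPi A B, sPi A' B' => seqb A A' &&& seqb B B'
  | sLam A b, sLam A' b' => seqb A A' &&& seqb b b'
  | sApp f a, sApp f' a' => seqb f f' &&& seqb a a'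
  | sCst c _ _, sCst d _ _ => cst_eqb c d
  | sGlob m, sGlob n => m =? n
  | _, _ => false
  end.

Fixpoint globs_below (k : nat) (t : src) : bool :=
  match t with
  | sVar _ | sUniv _ | sCst _ _ _ => true
  | sPi A B => globs_below k A &&& globs_below k B
  | sLam A b => globs_below k A &&& globs_below k b
  | sApp f a => globs_below k f &&& globs_below k a
  | sGlob n => n <? k
  end.

Fixpoint erase (bs : list tm) (t : src) : tm :=
  match t with
  | sVar n => Var n
  | sUniv i => Univ i
  | sPi A B => Pi (erase bs A) (erase bs B)
  | sLam A b => Lam (erase bs A) (erase bs b)
  | sApp f a => App (erase bs f) (erase bs a)
  | sCst c _ _ => Cst c
  | sGlob n => nth n bs (Univ 0)
  end.

(** The levels of the constants are not recorded in [tm]. Level 2 is high enough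
    for all types below, except that the truncation level [istrunc j k] in the types of
    [cTrLevel] and [cTrInd] depends on [j] up to conversion. *)
Fixpoint embed (t : tm) : src :=
  match t with
  | Var n => sVar n
  | Univ i => sUniv i
  | Pi A B => sPi (embed A) (embed B)
  | Lam A b => sLam (embed A) (embed b)
  | App f a => sApp (embed f) (embed a)
  | Cst (cTrInd as c) | Cst (cTrLevel as c) => sCst c 0 0
  | Cst c => sCst c 2 2
  end.

Record entry := Entry { e_type : src; e_body : src }.

Definition bind {A B} (m : option A) (f : A -> option B) : option B :=
  match m with Some a => f a | None => None end.
Notation "'let*' p ':=' m 'in' k" := (bind m (fun p => k))
  (at level 200, p pattern, m at level 100, k at level 200).

Section Env.
Variable env : list entry.

(** ** Evaluation and comparison *)

Definition scrutinee (c : cst) : option nat :=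
  match c with
  | cSigInd => Some 4
  | cNatInd => Some 3
  | cJ => Some 5
  | cSuspInd => Some 5
  | cEMInd => Some 6
  | cTrInd => Some 5
  | _ => None
  end.

Fixpoint spine (t : src) (l : list src) : src * list src :=
  match t with
  | sApp f a => spine f (a :: l)
  | _ => (t, l)
  end.

(** One computation step of the eliminator [c] on the arguments [stk], whose
    scrutinee is [p]. *)
Definition iota (c : cst) (stk : list src) (p : src) : option (src * list src) :=
  match spine p [] with
  | (sCst d _ _, l) =>
    match c, d, stk, l with
    | cSigInd, cPair, _ :: _ :: _ :: h :: _ :: k, [_; _; a; b] =>
        Some (h, a :: b :: k)
    | cNatInd, cZero, _ :: z :: _ :: _ :: k, [] => Some (z, k)
    | cNatInd, cSuc, C :: z :: s :: _ :: k, [n] =>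
        Some (s, n :: sapps (sCst cNatInd 2 2) [C; z; s; n] :: k)
    | cJ, cRefl, _ :: _ :: r :: _ :: _ :: _ :: k, [_; a] => Some (r, a :: k)
    | cSuspInd, cNorth, _ :: _ :: n :: _ :: _ :: _ :: k, [_] => Some (n, k)
    | cSuspInd, cSouth, _ :: _ :: _ :: s :: _ :: _ :: k, [_] => Some (s, k)
    | cEMInd, cBase, _ :: _ :: _ :: b :: _ :: _ :: _ :: k, [_; _] => Some (b, k)
    | cTrInd, cTrIn, _ :: _ :: _ :: _ :: f :: _ :: k, [_; _; a] =>
        Some (f, a :: k)
    | _, _, _, _ => None
    end
  | _ => None
  end.

(** [delta] says whether globals are unfolded. *)
Fixpoint whnf (delta : bool) (fuel : nat) (t : src) (stk : list src) : src :=
  match fuel with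
  | 0 => sapps t stk
  | S fuel =>
    match t with
    | sApp f a => whnf delta fuel f (a :: stk)
    | sLam A b =>
        match stk with
        | [] => t
        | a :: stk => whnf delta fuel (ssub 0 a b) stk
        end
    | sGlob n =>
        if delta then
          match nth_error env n with
          | Some e => whnf delta fuel (e_body e) stk
          | None => sapps t stk
          end
        else sapps t stk
    | sCst c i j =>
        match scrutinee c with
        | None => sapps t stk
        | Some k =>
          match nth_error stk k with
          | None => sapps t stk
          | Some p =>
            let p' := whnf delta fuel p [] in
            match iota c (firstn k stk ++ p' :: skipn (S k) stk) p' with
            | Some (r, stk) => whnf delta fuel r stk
            | None => sapps t stk
            end
          end
        end
    | _ => sapps t stk
    end
  end.

(** The global that blocks the evaluation of a term, and the term with this
    global replaced by its body. *)
Fixpoint unfold_head (fuel : nat) (t : src) : option (nat * src) :=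
  match fuel with
  | 0 => None
  | S fuel =>
    match spine t [] with
    | (sGlob n, l) =>
        match nth_error env n with
        | Some e => Some (n, sapps (e_body e) l)
        | None => None
        end
    | (sCst c i j, l) =>
        match scrutinee c with
        | None => None
        | Some k =>
          match nth_error l k with
          | None => None
          | Some p =>
            match unfold_head fuel (whnf false fuel p []) with
            | None => None
            | Some (n, p') =>
                Some (n, sapps (sCst c i j) (firstn k l ++ p' :: skipn (S k) l))
            end
          end
        end
    | _ => None
    end
  end.

Section Compare.
Variable cmp : src -> src -> bool.

Fixpoint compare_list (l l' : list src) : bool :=
  match l, l' with
  | [], [] => true
  | a :: l, a' :: l' => cmp a a' &&& compare_list l l'
  | _, _ => false
  end.

Definition atom_eqb (t u : src) : bool :=
  match t, u with
  | sVar _, sVar _ | sCst _ _ _, sCst _ _ _ | sGlob _, sGlob _ => seqb t u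
  | _, _ => false
  end.

(** Domains of abstractions are ignored, as [conv_lam_dom] allows. *)
Definition compare_struct (t u : src) : bool :=
  match t, u with
  | sUniv i, sUniv j => i =? j
  | sPi A B, sPi A' B' => cmp A A' &&& cmp B B'
  | sLam _ b, sLam _ b' => cmp b b'
  | sLam _ b, u => cmp b (sApp (slift 1 0 u) (sVar 0))
  | t, sLam _ b => cmp (sApp (slift 1 0 t) (sVar 0)) b
  | t, u =>
      let (h, l) := spine t [] in
      let (h', l') := spine u [] in
      atom_eqb h h' &&& compare_list l l'
  end.
End Compare.

(** Globals are unfolded only when a comparison of arguments fails, the most
    recent one first. *)
Fixpoint convb (fuel : nat) (t u : src) : bool :=
  match fuel with
  | 0 => false
  | S fuel =>
    if seqb t u then true else
    let t := whnf false fuel t [] in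
    let u := whnf false fuel u [] in
    if compare_struct (convb fuel) t u then true else
    match unfold_head fuel t, unfold_head fuel u with
    | Some (m, t'), Some (n, u') =>
        if m =? n then convb fuel t' u'
        else if m <? n then convb fuel t u' else convb fuel t' u
    | Some (_, t'), None => convb fuel t' u
    | None, Some (_, u') => convb fuel t u'
    | None, None => false
    end
  end.

(** ** Elaboration

    The functions return the elaborated term along with its type. Cumulativity
    applies to types only: a function into [U_i] is not a function into [U_j].
    Where it is used as one, [check] replaces it by its eta-expansion.

    Type formers are given the lowest possible level, from the levels of their
    arguments. Conversion is not known to preserve typing. Therefore [as_pi]
    elaborates a function type again if it was exposed by evaluation. *)

Fixpoint infer (fuel : nat) (G : list src) (t : src) : option (src * src) :=
  match fuel with
  | 0 => None
  | S fuel =>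
    match t with
    | sVar n =>
        match nth_error G n with
        | Some A => Some (t, slift (S n) 0 A)
        | None => None
        end
    | sUniv i => Some (t, sUniv (S i))
    | sGlob n =>
        match nth_error env n with
        | Some e => Some (t, e_type e)
        | None => None
        end
    | sCst c i j =>
        let* (T, _) := infer_type fuel [] (embed (close (cst_type i j c))) in
        if convb fuel T (embed (close (cst_type i j c))) then Some (t, T)
        else None
    | sPi A B =>
        let* (A, i) := infer_type fuel G A in
        let* (B, j) := infer_type fuel (A :: G) B in
        Some (sPi A B, sUniv (Nat.max i j))
    | sLam A b =>
        let* (A, i) := infer_type fuel G A in
        let* (b, B) := infer fuel (A :: G) b in
        Some (sLam A b, sPi A B)
    | sApp (sApp (sApp (sCst cId i j) A) a) b =>
        let* (A, k) := infer_type fuel G A in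
        let* a := check fuel G a A in
        let* b := check fuel G b A in
        Some (sApp (sApp (sApp (sCst cId i j) A) a) b, sUniv k)
    | sApp (sApp (sCst cSig i j) A) B =>
        let* (A, k) := infer_type fuel G A in
        let b := match B with
                 | sLam _ b => b
                 | _ => sApp (slift 1 0 B) (sVar 0)
                 end in
        let* (b, l) := infer_type fuel (A :: G) b in
        Some (sApp (sApp (sCst cSig i j) A) (sLam A b), sUniv (Nat.max k l))
    | sApp (sApp (sCst cTr i j) n) A =>
        let* n := check fuel G n (sCst cNat 2 2) in
        let* (A, k) := infer_type fuel G A in
        Some (sApp (sApp (sCst cTr i j) n) A, sUniv k)
    | sApp (sApp (sCst cEM i j) A) f =>
        let* (A, k) := infer_type fuel G A in
        let* f := check fuel G f (sPi A (sPi (slift 1 0 A) (slift 2 0 A))) in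
        Some (sApp (sApp (sCst cEM i j) A) f, sUniv k)
    | sApp (sCst cSusp i j) A =>
        let* (A, k) := infer_type fuel G A in
        Some (sApp (sCst cSusp i j) A, sUniv k)
    | sApp f a =>
        let* (f, F) := infer fuel G f in
        let* (A, B) := as_pi fuel G F in
        let* a := check fuel G a A in
        Some (sApp f a, ssub 0 a B)
    end
  end

with infer_type (fuel : nat) (G : list src) (t : src) : option (src * nat) :=
  match fuel with
  | 0 => None
  | S fuel =>
    match t with
    | sCst cNat i j => Some (t, 0)
    | _ =>
      let* (t, T) := infer fuel G t in
      match whnf true fuel T [] with
      | sUniv k => Some (t, k)
      | _ => None
      end
    end
  end

with as_pi (fuel : nat) (G : list src) (F : src) : option (src * src) :=
  match fuel with
  | 0 => None
  | S fuel =>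
    match F with
    | sPi A B => Some (A, B)
    | _ =>
      let P := whnf true fuel F [] in
      match P with
      | sPi _ _ =>
        let* (P', _) := infer_type fuel G P in
        match P' with
        | sPi A B => if convb fuel P P' then Some (A, B) else None
        | _ => None
        end
      | _ => None
      end
    end
  end

with check (fuel : nat) (G : list src) (t T : src) : option src :=
  match fuel with
  | 0 => None
  | S fuel =>
    match t with
    | sLam A' b =>
        let* (A, B) := as_pi fuel G T in
        let* (A', _) := infer_type fuel G A' in
        if convb fuel A' A then
          let* b := check fuel (A' :: G) b B in
          Some (sLam A' b)
        else None
    | _ =>
        let* (t, T') := infer fuel G t in
        match whnf false fuel T' [], whnf true fuel T [] with
        | sUniv i, sUniv j => if i <=? j then Some t else None
        | _, P =>
          if convb fuel T' T then Some t
          else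
            match P with
            | sPi _ _ =>
              let* (A, B) := as_pi fuel G T in
              let* b := check fuel (A :: G) (sApp (slift 1 0 t) (sVar 0)) B in
              Some (sLam A b)
            | _ => None
            end
        end
    end
  end.

End Env.

End Checker.

Import Meta Checker.

(** * Soundness of the type checker *)

Module Soundness.

Lemma seqb_erase bs t : forall u, seqb t u = true -> erase bs t = erase bs u.
Proof.
  induction t; intros []; cbn; try discriminate;
    rewrite ?and_true_iff, ?Nat.eqb_eq; intros E;
    first [ congruence | f_equal; apply cst_eqb_eq; assumption | destruct E; f_equal; auto ].
Qed.

Lemma erase_embed bs t : erase bs (embed t) = t.
Proof. induction t; cbn; f_equal; auto. destruct c; reflexivity. Qed.

(** Extending the list of definitions does not affect terms that refer to the
    earlier ones only. *)
Lemma erase_globs_below bs bs' t :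
  globs_below (length bs) t = true -> erase (bs ++ bs') t = erase bs t.
Proof.
  induction t; cbn -[Nat.ltb]; rewrite ?and_true_iff; intros H;
    first [apply app_nth1, Nat.ltb_lt; assumption | try destruct H; f_equal; auto].
Qed.

Section Env.
Variable env : list entry.
Variable bs : list tm.
Notation "⟦ t ⟧" := (erase bs t).

Record entry_ok (e : entry) (b : tm) : Prop := {
  entry_erase : ⟦e_body e⟧ = b;
  entry_typing : typing nil b ⟦e_type e⟧;
  entry_type : exists k, typing nil ⟦e_type e⟧ (Univ k) }.

Hypothesis env_ok : Forall2 entry_ok env bs.

Lemma env_nth n e : nth_error env n = Some e -> entry_ok e (nth n bs (Univ 0)).
Proof.
  clear - env_ok. revert n; induction env_ok; intros [|n] E; cbn in *; try discriminate.
  - injection E as <-; auto.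
  - auto.
Qed.

Lemma bodies_closed n : closed_at 0 (nth n bs (Univ 0)) = true.
Proof.
  clear - env_ok. revert n; induction env_ok as [|? ? ? ? [_ Ht _]];
    intros [|n]; cbn; auto.
  apply (typing_closed_at _ _ _ Ht).
Qed.

(** ** Erasure commutes with substitution *)

Lemma erase_slift t : forall n k,
  ⟦slift n k t⟧ = rename (fun m => if m <? k then m else n + m) ⟦t⟧.
Proof.
  induction t; intros m k; cbn -[Nat.ltb]; f_equal; auto.
  - destruct (n <? k); reflexivity.
  - rewrite IHt2; apply rename_ext; intros [|n]; cbn -[Nat.ltb]; auto.
    change (S n <? S k) with (n <? k). destruct (n <? k); auto.
  - rewrite IHt2; apply rename_ext; intros [|n]; cbn -[Nat.ltb]; auto.
    change (S n <? S k) with (n <? k). destruct (n <? k); auto.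
  - rewrite closed_rename; auto using bodies_closed.
Qed.

Lemma erase_slift0 t n : ⟦slift n 0 t⟧ = rename (Nat.add n) ⟦t⟧.
Proof. rewrite erase_slift; apply rename_ext; reflexivity. Qed.

Lemma erase_ssub_at a t : forall k,
  ⟦ssub k a t⟧ = subst (fun m => match Nat.compare m k with
                                  | Lt => Var m
                                  | Eq => rename (Nat.add k) ⟦a⟧
                                  | Gt => Var (pred m)
                                  end) ⟦t⟧.
Proof.
  induction t; intros k; cbn; f_equal; auto.
  - destruct (n ?= k); auto. apply erase_slift0.
  - rewrite IHt2; apply subst_ext; intros [|n]; cbn; auto.
    destruct (n ?= k) eqn:E; cbn; auto.
    + rewrite rename_rename; apply rename_ext; reflexivity.
    + apply Nat.compare_gt_iff in E. destruct n; [lia|reflexivity].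
  - rewrite IHt2; apply subst_ext; intros [|n]; cbn; auto.
    destruct (n ?= k) eqn:E; cbn; auto.
    + rewrite rename_rename; apply rename_ext; reflexivity.
    + apply Nat.compare_gt_iff in E. destruct n; [lia|reflexivity].
  - rewrite closed_subst; auto using bodies_closed.
Qed.

Lemma erase_ssub a t : ⟦ssub 0 a t⟧ = subst1 ⟦a⟧ ⟦t⟧.
Proof.
  rewrite erase_ssub_at; apply subst_ext; intros [|n]; cbn; auto.
  rewrite rename_as_subst; apply subst_Var; reflexivity.
Qed.

Lemma erase_sapps l : forall t, ⟦sapps t l⟧ = apps ⟦t⟧ (map (erase bs) l).
Proof. induction l; intros t; cbn; auto. apply IHl. Qed.

Lemma spine_sapps t : forall l, let (h, l') := spine t l in sapps h l' = sapps t l.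
Proof.
  induction t; intros l; cbn; auto. apply (IHt1 (t2 :: l)).
Qed.

Lemma spine_eq t h l : spine t [] = (h, l) -> t = sapps h l.
Proof. intros E. pose proof (spine_sapps t []) as H. rewrite E in H. auto. Qed.

(** ** Conversion *)

Lemma conv_apps_head f g l : conv f g -> conv (apps f l) (apps g l).
Proof.
  intros H; apply conv_apps; auto.
  induction l; constructor; auto using conv_refl.
Qed.

Lemma conv_apps_nth f l k p q :
  nth_error l k = Some p -> conv p q ->
  conv (apps f l) (apps f (firstn k l ++ q :: skipn (S k) l)).
Proof.
  intros E H; apply conv_apps; [apply conv_refl|].
  revert k E; induction l; intros [|k] E; cbn in *; try discriminate.
  - injection E as ->. constructor; auto.
    clear; induction l; constructor; auto using conv_refl.
  - constructor; auto using conv_refl.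
Qed.

Lemma iota_sound c i j stk p r stk' k :
  iota c stk p = Some (r, stk') -> scrutinee c = Some k -> nth_error stk k = Some p ->
  conv ⟦sapps (sCst c i j) stk⟧ ⟦sapps r stk'⟧.
Proof.
  unfold iota. destruct (spine p []) as [h l] eqn:E.
  apply spine_eq in E; subst p.
  destruct h; try discriminate.
  destruct c; try discriminate; destruct c0; try discriminate;
    repeat match goal with
    | |- match ?s with [] => _ | _ :: _ => _ end = _ -> _ =>
        let x := fresh "x" in destruct s as [|x ?]; try discriminate
    end;
    intros [= <- <-] [= <-] [= ->];
    rewrite !erase_sapps; cbn [map apps fold_left];
    apply (conv_apps_head _ _ (map (erase bs) _)); cbn;
    first [ apply conv_sig | apply conv_zero | apply conv_suc | apply conv_J
          | apply conv_north | apply conv_south | apply conv_base | apply conv_tr ].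
Qed.

Lemma whnf_sound d fuel : forall t stk,
  conv ⟦sapps t stk⟧ ⟦whnf env d fuel t stk⟧.
Proof.
  induction fuel as [|fuel IH]; intros t stk; cbn [whnf]; [apply conv_refl|].
  destruct t; try apply conv_refl.
  - destruct stk as [|a stk]; [apply conv_refl|].
    eapply conv_trans; [|apply IH].
    rewrite !erase_sapps. cbn [map apps fold_left]. apply conv_apps_head.
    rewrite erase_ssub. apply conv_beta.
  - apply (IH t1 (t2 :: stk)).
  - destruct (scrutinee c) as [k|] eqn:Ec; [|apply conv_refl].
    destruct (nth_error stk k) as [p|] eqn:Ep; [|apply conv_refl].
    set (p' := whnf env d fuel p []).
    destruct (iota c _ p') as [[r stk']|] eqn:Ei; [|apply conv_refl].
    eapply conv_trans; [|apply IH].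
    eapply conv_trans; [|eapply iota_sound; eauto].
    + rewrite !erase_sapps, map_app; cbn [map].
      rewrite <- firstn_map, <- skipn_map.
      apply conv_apps_nth with (p := ⟦p⟧).
      * rewrite nth_error_map, Ep; reflexivity.
      * apply (IH p []).
    + pose proof (nth_error_Some stk k) as H. rewrite Ep in H.
      rewrite nth_error_app2; rewrite firstn_length_le;
        rewrite ?Nat.sub_diag; auto; try lia.
      all: assert (k < length stk) by (apply H; discriminate); lia.
  - destruct d; [|apply conv_refl].
    destruct (nth_error env n) as [e|] eqn:E; [|apply conv_refl].
    eapply conv_trans; [|apply IH].
    rewrite !erase_sapps; apply conv_apps_head.
    destruct (env_nth _ _ E) as [Eb _ _]; cbn. rewrite Eb; apply conv_refl.
Qed.

Lemma whnf_sound0 d fuel t : conv ⟦t⟧ ⟦whnf env d fuel t []⟧.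
Proof. apply (whnf_sound d fuel t []). Qed.

Lemma unfold_head_sound fuel : forall t n u,
  unfold_head env fuel t = Some (n, u) -> conv ⟦t⟧ ⟦u⟧.
Proof.
  induction fuel as [|fuel IH]; intros t n u; cbn [unfold_head]; [discriminate|].
  destruct (spine t []) as [h l] eqn:E; apply spine_eq in E; subst t.
  destruct h; try discriminate.
  - destruct (scrutinee c) as [k|] eqn:Ec; [|discriminate].
    destruct (nth_error l k) as [p|] eqn:Ep; [|discriminate].
    destruct (unfold_head env fuel _) as [[m p']|] eqn:Eu; [|discriminate].
    intros [= <- <-]. apply IH in Eu.
    change (match l with [] => [] | _ :: l0 => skipn k l0 end) with (skipn (S k) l).
    rewrite !erase_sapps, map_app; cbn [map].
    rewrite <- firstn_map, <- skipn_map.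
    apply conv_apps_nth with (p := ⟦p⟧).
    + rewrite nth_error_map, Ep; reflexivity.
    + eapply conv_trans; [apply whnf_sound0|exact Eu].
  - destruct (nth_error env n0) as [e|] eqn:E; [|discriminate].
    intros [= <- <-]. rewrite !erase_sapps; apply conv_apps_head.
    destruct (env_nth _ _ E) as [Eb _ _]; cbn. rewrite Eb; apply conv_refl.
Qed.

Definition cmp_sound (cmp : src -> src -> bool) : Prop :=
  forall t u, cmp t u = true -> conv ⟦t⟧ ⟦u⟧.

Lemma compare_list_sound cmp : cmp_sound cmp -> forall l l',
  compare_list cmp l l' = true -> Forall2 conv (map (erase bs) l) (map (erase bs) l').
Proof.
  intros H; induction l; intros [|a' l']; cbn; try discriminate; constructor.
  - apply and_true_iff in H0 as [? ?]; auto.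
  - apply and_true_iff in H0 as [? ?]; auto.
Qed.

Lemma atom_eqb_sound t u : atom_eqb t u = true -> ⟦t⟧ = ⟦u⟧.
Proof. destruct t, u; try discriminate; apply seqb_erase. Qed.

Lemma compare_spine_sound cmp t u : cmp_sound cmp ->
  (let (h, l) := spine t [] in
   let (h', l') := spine u [] in
   atom_eqb h h' &&& compare_list cmp l l') = true -> conv ⟦t⟧ ⟦u⟧.
Proof.
  intros H.
  destruct (spine t []) as [h l] eqn:E; apply spine_eq in E; subst t.
  destruct (spine u []) as [h' l'] eqn:E; apply spine_eq in E; subst u.
  rewrite and_true_iff; intros [Eh El]. rewrite !erase_sapps.
  apply conv_apps; [|eapply compare_list_sound; eauto].
  rewrite (atom_eqb_sound _ _ Eh); apply conv_refl.
Qed.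

Lemma eta_sound cmp A b u : cmp_sound cmp ->
  cmp b (sApp (slift 1 0 u) (sVar 0)) = true -> conv (Lam A ⟦b⟧) ⟦u⟧.
Proof.
  intros H E; apply H in E; cbn in E. rewrite erase_slift0 in E.
  eapply conv_trans; [|apply (conv_eta A)].
  apply conv_lam; [apply conv_refl|exact E].
Qed.

Lemma eta_sound' cmp A b u : cmp_sound cmp ->
  cmp (sApp (slift 1 0 u) (sVar 0)) b = true -> conv ⟦u⟧ (Lam A ⟦b⟧).
Proof.
  intros H E; apply H in E; cbn in E. rewrite erase_slift0 in E.
  eapply conv_trans; [apply conv_sym, (conv_eta A)|].
  apply conv_lam; [apply conv_refl|exact E].
Qed.

Lemma compare_struct_sound cmp t u : cmp_sound cmp ->
  compare_struct cmp t u = true -> conv ⟦t⟧ ⟦u⟧.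
Proof.
  intros H.
  destruct t, u; unfold compare_struct;
    try solve [ apply compare_spine_sound; auto | apply eta_sound; auto
              | apply eta_sound'; auto ].
  - rewrite Nat.eqb_eq; intros ->; apply conv_refl.
  - rewrite and_true_iff; intros [? ?]; apply conv_pi; apply H; auto.
  - intros E. cbn. eapply conv_trans; [apply conv_lam_dom|].
    apply conv_lam; [apply conv_refl|apply H; auto].
Qed.

Lemma convb_sound fuel : cmp_sound (convb env fuel).
Proof.
  induction fuel as [|fuel IH]; intros t u; cbn [convb]; [discriminate|].
  destruct (seqb t u) eqn:Es.
  { intros _. rewrite (seqb_erase _ _ _ Es). apply conv_refl. }
  intros E.
  eapply conv_trans; [apply (whnf_sound0 false fuel)|].
  eapply conv_trans; [|apply conv_sym, (whnf_sound0 false fuel)].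
  revert E. set (t' := whnf env false fuel t []). set (u' := whnf env false fuel u []).
  destruct (compare_struct (convb env fuel) t' u') eqn:Ec.
  { intros _; eapply compare_struct_sound; eauto. }
  destruct (unfold_head env fuel t') as [[m t2]|] eqn:Et;
    destruct (unfold_head env fuel u') as [[n u2]|] eqn:Eu;
    try apply unfold_head_sound in Et; try apply unfold_head_sound in Eu;
    try discriminate.
  - destruct (m =? n); [|destruct (m <? n)]; intros E; apply IH in E.
    + eapply conv_trans; [exact Et|]. eapply conv_trans; [exact E|]. apply conv_sym; auto.
    + eapply conv_trans; [exact E|]. apply conv_sym; auto.
    + eapply conv_trans; [exact Et|]. exact E.
  - intros E; apply IH in E. eapply conv_trans; [exact Et|]. exact E.
  - intros E; apply IH in E. eapply conv_trans; [exact E|]. apply conv_sym; auto.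
Qed.

(** ** Typing *)

Notation "⟦ G ⟧*" := (map (erase bs) G).

Definition is_type (G : list tm) (A : tm) : Prop := exists k, typing G A (Univ k).

Definition ctx_ok (G : list src) : Prop :=
  forall n A, nth_error G n = Some A -> is_type ⟦G⟧* (rename (Nat.add (S n)) ⟦A⟧).

Lemma ctx_ok_nil : ctx_ok [].
Proof. intros [|n] A; discriminate. Qed.

Lemma ctx_ok_cons G A k : ctx_ok G -> typing ⟦G⟧* ⟦A⟧ (Univ k) -> ctx_ok (A :: G).
Proof.
  intros HG HA [|n] B E; cbn in E.
  - injection E as <-. exists k. apply (typing_weaken _ _ _ ⟦A⟧ HA).
  - destruct (HG _ _ E) as [l Hl]. exists l.
    pose proof (typing_weaken _ _ _ ⟦A⟧ Hl) as V. rewrite rename_rename in V. exact V.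
Qed.

Lemma typing_to_univ G t T k :
  typing G t T -> conv T (Univ k) -> typing G t (Univ k).
Proof. intros H HT; eapply ty_conv; eauto using ty_univ. Qed.

Lemma is_type_pi G A B :
  is_type G (Pi A B) -> is_type G A /\ is_type (A :: G) B.
Proof. intros [k H]; apply typing_Pi_inv in H as (i & ? & ?); split; eexists; eauto. Qed.

Lemma is_type_mk_pi G A B i :
  typing G A (Univ i) -> is_type (A :: G) B -> is_type G (Pi A B).
Proof.
  intros HA [j HB]. exists (Nat.max i j). apply ty_pi.
  - apply typing_cumul_le with i; auto; lia.
  - apply typing_cumul_le with j; auto; lia.
Qed.

Lemma typing_of_cst G c i j T :
  close (cst_type i j c) = T -> typing G (Cst c) T.
Proof. intros <-; apply ty_cst. Qed.

(** The types of the type formers, at the level [k] of their arguments. *)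
Lemma typing_Id G A a b k : typing G A (Univ k) -> typing G a A -> typing G b A ->
  typing G (App (App (App (Cst cId) A) a) b) (Univ k).
Proof.
  intros HA Ha Hb.
  pose proof (ty_app _ _ _ _ _ (ty_cst G cId k 0) HA) as H; cbn in H.
  pose proof (ty_app _ _ _ _ _ H Ha) as H1. cbn in H1.
  change (typing G (App (App (Cst cId) A) a) (Pi (subst1 a (rename S A)) (Univ k))) in H1.
  rewrite subst1_rename_S in H1.
  exact (ty_app _ _ _ _ _ H1 Hb).
Qed.

Lemma typing_Sig G A B k : typing G A (Univ k) -> typing (A :: G) B (Univ k) ->
  typing G (App (App (Cst cSig) A) (Lam A B)) (Univ k).
Proof.
  intros HA HB.
  pose proof (ty_app _ _ _ _ _ (ty_cst G cSig k 0) HA) as H; cbn in H.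
  exact (ty_app _ _ _ _ _ H (ty_lam _ _ _ _ _ HA HB)).
Qed.

Lemma typing_Susp G A k : typing G A (Univ k) ->
  typing G (App (Cst cSusp) A) (Univ k).
Proof. intros HA. exact (ty_app _ _ _ _ _ (ty_cst G cSusp k 0) HA). Qed.

Lemma typing_Tr G n A k : typing G n (Cst cNat) -> typing G A (Univ k) ->
  typing G (App (App (Cst cTr) n) A) (Univ k).
Proof.
  intros Hn HA.
  pose proof (ty_app _ _ _ _ _ (ty_cst G cTr k 0) Hn) as H; cbn in H.
  exact (ty_app _ _ _ _ _ H HA).
Qed.

Lemma typing_EM G A f k : typing G A (Univ k) ->
  typing G f (Pi A (Pi (rename S A) (rename (Nat.add 2) A))) ->
  typing G (App (App (Cst cEM) A) f) (Univ k).
Proof.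
  intros HA Hf.
  pose proof (ty_app _ _ _ _ _ (ty_cst G cEM k 0) HA) as H; cbn in H.
  refine (ty_app _ _ _ _ _ H _).
  replace (rename (Nat.add 2) A) with (rename S (rename S A)) in Hf
    by (rewrite rename_rename; reflexivity).
  exact Hf.
Qed.

Definition infer_sound fuel := forall G t u T, ctx_ok G ->
  infer env fuel G t = Some (u, T) ->
  typing ⟦G⟧* ⟦u⟧ ⟦T⟧ /\ is_type ⟦G⟧* ⟦T⟧.
Definition infer_type_sound fuel := forall G t u k, ctx_ok G ->
  infer_type env fuel G t = Some (u, k) -> typing ⟦G⟧* ⟦u⟧ (Univ k).
Definition as_pi_sound fuel := forall G F A B, ctx_ok G -> is_type ⟦G⟧* ⟦F⟧ ->
  as_pi env fuel G F = Some (A, B) ->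
  conv ⟦F⟧ (Pi ⟦A⟧ ⟦B⟧) /\ is_type ⟦G⟧* (Pi ⟦A⟧ ⟦B⟧).
Definition check_sound fuel := forall G t T u, ctx_ok G -> is_type ⟦G⟧* ⟦T⟧ ->
  check env fuel G t T = Some u -> typing ⟦G⟧* ⟦u⟧ ⟦T⟧.

Lemma bind_Some {A B} (m : option A) (f : A -> option B) b :
  bind m f = Some b -> exists a, m = Some a /\ f a = Some b.
Proof. destruct m; cbn; [eauto|discriminate]. Qed.

Ltac bind_inv H :=
  let x := fresh "x" in let E := fresh "E" in
  apply bind_Some in H as (x & E & H);
  match type of x with (_ * _)%type => destruct x | _ => idtac end;
  cbn beta iota in H.

Lemma app_sound fuel G f a u T :
  infer_sound fuel -> as_pi_sound fuel -> check_sound fuel -> ctx_ok G ->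
  (let* (f, F) := infer env fuel G f in
   let* (A, B) := as_pi env fuel G F in
   let* a := check env fuel G a A in
   Some (sApp f a, ssub 0 a B)) = Some (u, T) ->
  typing ⟦G⟧* ⟦u⟧ ⟦T⟧ /\ is_type ⟦G⟧* ⟦T⟧.
Proof.
  intros Hi Hp Hc HG H. bind_inv H. bind_inv H. bind_inv H.
  injection H as <- <-.
  apply Hi in E as [Hf HF]; auto.
  apply Hp in E0 as [Hconv HPi]; auto.
  destruct (is_type_pi _ _ _ HPi) as [HA [k HB]].
  apply Hc in E1; auto. rewrite erase_ssub; cbn [erase]. split.
  - refine (ty_app _ _ _ _ _ _ E1).
    destruct HPi as [l HPi]. exact (ty_conv _ _ _ _ _ Hf Hconv HPi).
  - exists k. exact (typing_subst1 _ _ _ _ _ HB E1).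
Qed.

Lemma check_all_sound fuel :
  infer_sound fuel /\ infer_type_sound fuel /\ as_pi_sound fuel /\ check_sound fuel.
Proof.
  induction fuel as [|fuel (Hi & Ht & Hp & Hc)].
  { repeat split; intros; discriminate. }
  assert (Hi' : infer_sound (S fuel)).
  { intros G t u T HG H.
    destruct t; cbn [infer] in H.
    - destruct (nth_error G n) as [A|] eqn:E; [|discriminate].
      injection H as <- <-. rewrite erase_slift0. cbn. split.
      + apply (ty_var ⟦G⟧* n ⟦A⟧). rewrite nth_error_map, E; reflexivity.
      + apply HG; auto.
    - injection H as <- <-; cbn; split; [|eexists]; apply ty_univ.
    - bind_inv H. bind_inv H. injection H as <- <-.
      apply Ht in E; auto. apply Ht in E0; [|eapply ctx_ok_cons; eauto].
      cbn; split; [|eexists; apply ty_univ].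
      apply ty_pi; (eapply typing_cumul_le; [|eassumption]; lia).
    - bind_inv H. bind_inv H. injection H as <- <-.
      apply Ht in E; auto. apply Hi in E0 as [? ?]; [|eapply ctx_ok_cons; eauto].
      cbn; split; [eapply ty_lam|eapply is_type_mk_pi]; eauto.
    - destruct t1; try (eapply app_sound; eauto; fail).
      + destruct t1_1; try (eapply app_sound; eauto; fail).
        * destruct t1_1_1; try (eapply app_sound; eauto; fail).
          destruct c; try (eapply app_sound; eauto; fail).
          bind_inv H. bind_inv H. bind_inv H. injection H as <- <-.
          apply Ht in E; auto. apply Hc in E0; [|auto|eexists; eauto].
          apply Hc in E1; [|auto|eexists; eauto].
          cbn; split; [apply typing_Id; auto|eexists; apply ty_univ].
        * destruct c; try (eapply app_sound; eauto; fail).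
          -- bind_inv H. bind_inv H. injection H as <- <-.
             apply Ht in E; auto. apply Ht in E0; [|eapply ctx_ok_cons; eauto].
             cbn; split; [|eexists; apply ty_univ].
             apply typing_Sig; (eapply typing_cumul_le; [|eassumption]; lia).
          -- bind_inv H. bind_inv H. injection H as <- <-.
             apply Ht in E; auto. apply Hc in E0; auto.
             { cbn; split; [|eexists; apply ty_univ]. apply typing_EM; auto.
               cbn in E0. rewrite !erase_slift0 in E0. exact E0. }
             cbn. rewrite !erase_slift0.
             exists n. pose proof (typing_weaken _ _ _ ⟦s⟧ E) as W.
             apply ty_pi; auto. apply ty_pi; [exact W|].
             pose proof (typing_weaken _ _ _ (rename S ⟦s⟧) W) as W'.
             rewrite rename_rename in W'. exact W'.
          -- bind_inv H. bind_inv H. injection H as <- <-.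
             apply Hc in E; [|auto|exists 0; apply (typing_of_cst _ _ 0 0); reflexivity].
             apply Ht in E0; auto.
             cbn; split; [apply typing_Tr; auto|eexists; apply ty_univ].
      + destruct c; try (eapply app_sound; eauto; fail).
        bind_inv H. injection H as <- <-. apply Ht in E; auto.
        cbn; split; [apply typing_Susp; auto|eexists; apply ty_univ].
    - bind_inv H. destruct (convb env fuel s _) eqn:Ec; [|discriminate].
      injection H as <- <-. apply Ht in E; [|apply ctx_ok_nil].
      apply convb_sound in Ec. rewrite erase_embed in Ec.
      assert (typing ⟦G⟧* ⟦s⟧ (Univ n)).
      { apply typing_closed_weaken; auto. }
      split; [|eexists; eauto].
      eapply ty_conv; [apply ty_cst|apply conv_sym; exact Ec|eauto].
    - destruct (nth_error env n) as [e|] eqn:E; [|discriminate].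
      injection H as <- <-. destruct (env_nth _ _ E) as [_ H1 [k H2]].
      pose proof (typing_closed_at _ _ _ H2). cbn [erase]. split; [|exists k];
      apply typing_closed_weaken; auto. }
  refine (conj Hi' (conj _ (conj _ _))); clear Hi'.
  - intros G t u k HG H. cbn [infer_type] in H.
    assert (Hgen : (let* (t, T) := infer env fuel G t in
      match whnf env true fuel T [] with
      | sUniv k => Some (t, k)
      | _ => None
      end) = Some (u, k) -> typing ⟦G⟧* ⟦u⟧ (Univ k)).
    { clear H; intros H. bind_inv H.
      destruct (whnf env true fuel s0 []) eqn:Ew; try discriminate.
      injection H as <- <-. apply Hi in E as [E _]; auto.
      eapply typing_to_univ; eauto. pose proof (whnf_sound0 true fuel s0) as W.
      rewrite Ew in W; exact W. }
    destruct t; auto. destruct c; auto. injection H as <- <-.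
    apply (typing_of_cst _ _ 0 0); reflexivity.
  - intros G F A B HG HF H. cbn [as_pi] in H.
    assert (Hgen : (let P := whnf env true fuel F [] in
      match P with
      | sPi _ _ =>
        let* (P', _) := infer_type env fuel G P in
        match P' with
        | sPi A B => if convb env fuel P P' then Some (A, B) else None
        | _ => None
        end
      | _ => None
      end) = Some (A, B) ->
      conv ⟦F⟧ (Pi ⟦A⟧ ⟦B⟧) /\ is_type ⟦G⟧* (Pi ⟦A⟧ ⟦B⟧)).
    { clear H; cbv zeta. pose proof (whnf_sound0 true fuel F) as W; revert W.
      set (P := whnf env true fuel F []). intros W H.
      destruct P; try discriminate. bind_inv H. destruct s; try discriminate.
      destruct (convb env fuel _ _) eqn:Ec; [|discriminate]. injection H as <- <-.
      apply Ht in E; auto. apply convb_sound in Ec.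
      split; [eapply conv_trans; eauto|eexists; exact E]. }
    destruct F; auto. injection H as <- <-. split; auto using conv_refl.
  - intros G t T u HG HT H. cbn [check] in H.
    assert (Hgen : (let* (t, T') := infer env fuel G t in
        match whnf env false fuel T' [], whnf env true fuel T [] with
        | sUniv i, sUniv j => if i <=? j then Some t else None
        | _, P =>
          if convb env fuel T' T then Some t
          else
            match P with
            | sPi _ _ =>
              let* (A, B) := as_pi env fuel G T in
              let* b := check env fuel (A :: G) (sApp (slift 1 0 t) (sVar 0)) B in
              Some (sLam A b)
            | _ => None
            end
        end) = Some u -> typing ⟦G⟧* ⟦u⟧ ⟦T⟧).
    { clear H; intros H. bind_inv H. apply Hi in E as [E E']; auto.
      assert (Hlam : forall t, (let* (A, B) := as_pi env fuel G T in
              let* b := check env fuel (A :: G) t B in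
              Some (sLam A b)) = Some u -> typing ⟦G⟧* ⟦u⟧ ⟦T⟧).
      { clear H; intros t' H. bind_inv H. bind_inv H. injection H as <-.
        apply Hp in E0 as [Hconv HPi]; auto.
        destruct (is_type_pi _ _ _ HPi) as [[k HA] HB].
        apply Hc in E1; [|eapply ctx_ok_cons; eauto|exact HB].
        destruct HT as [l HT]. eapply ty_conv; [|apply conv_sym; eauto|eauto].
        cbn; eapply ty_lam; eauto. }
      assert (Hgen2 : forall P, (if convb env fuel s0 T then Some s
          else
            match P with
            | sPi _ _ =>
              let* (A, B) := as_pi env fuel G T in
              let* b := check env fuel (A :: G) (sApp (slift 1 0 s) (sVar 0)) B in
              Some (sLam A b)
            | _ => None
            end) = Some u -> typing ⟦G⟧* ⟦u⟧ ⟦T⟧).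
      { clear H; intros P H. destruct (convb env fuel s0 T) eqn:Ec.
        - injection H as <-. apply convb_sound in Ec. destruct HT as [k HT].
          eapply ty_conv; eauto.
        - destruct P; try discriminate. eapply Hlam; eauto. }
      pose proof (whnf_sound0 false fuel s0) as W.
      pose proof (whnf_sound0 true fuel T) as W'.
      destruct (whnf env false fuel s0 []) as [|l| | | | |];
        destruct (whnf env true fuel T []) as [|l'|A B| | | |];
        try exact (Hgen2 (sVar 0) H); try exact (Hgen2 (sPi A B) H).
      destruct (l <=? l') eqn:El; [|discriminate]. injection H as <-.
      apply Nat.leb_le in El. destruct HT as [k HT].
      eapply ty_conv; [|apply conv_sym; eauto|eauto].
      eapply typing_cumul_le; [eassumption|]. eapply typing_to_univ; eauto. }
    destruct t; auto. clear Hgen.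
    bind_inv H. bind_inv H. destruct (convb env fuel _ _) eqn:Ec; [|discriminate].
    bind_inv H. injection H as <-. apply convb_sound in Ec.
    apply Hp in E as [Hconv HPi]; auto. apply Ht in E0; auto.
    destruct (is_type_pi _ _ _ HPi) as [[k HA] [k' HB]].
    assert (HB' := typing_conv_ctx _ _ _ _ _ _ _ HA E0 Ec HB).
    apply Hc in E1; [|eapply ctx_ok_cons; eauto|eexists; exact HB'].
    destruct HT as [l HT]. eapply ty_conv; [cbn; eapply ty_lam; eauto| |eauto].
    eapply conv_trans; [apply conv_pi; [exact Ec|apply conv_refl]|].
    apply conv_sym; exact Hconv.
Qed.

Lemma infer_type_ok fuel G t u k : ctx_ok G ->
  infer_type env fuel G t = Some (u, k) -> typing ⟦G⟧* ⟦u⟧ (Univ k).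
Proof. apply check_all_sound. Qed.

Lemma check_ok fuel G t T u : ctx_ok G -> is_type ⟦G⟧* ⟦T⟧ ->
  check env fuel G t T = Some u -> typing ⟦G⟧* ⟦u⟧ ⟦T⟧.
Proof. apply check_all_sound. Qed.

End Env.

(** ** Programs *)

Definition check_entry (fuel : nat) (env : list entry) (e : entry) : option entry :=
  let* (T, _) := infer_type env fuel [] (e_type e) in
  let* b := check env fuel [] (e_body e) T in
  if globs_below (length env) T &&& globs_below (length env) b
  then Some (Entry T b) else None.

Fixpoint check_program (fuel : nat) (env prog : list entry) : option (list entry) :=
  match prog with
  | [] => Some env
  | e :: prog =>
      let* e := check_entry fuel env e in
      check_program fuel (env ++ [e]) prog
  end.

Lemma entry_ok_app bs bs' e b :
  globs_below (length bs) (e_type e) = true ->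
  globs_below (length bs) (e_body e) = true ->
  entry_ok bs e b -> entry_ok (bs ++ bs') e b.
Proof.
  intros HT Hb [H1 H2 H3].
  constructor; rewrite erase_globs_below; auto.
Qed.

Definition program_ok (env : list entry) (bs : list tm) : Prop :=
  Forall2 (entry_ok bs) env bs /\
  Forall (fun e => globs_below (length bs) (e_type e) = true /\
                   globs_below (length bs) (e_body e) = true) env.

Lemma globs_below_le k l t : k <= l -> globs_below k t = true -> globs_below l t = true.
Proof.
  intros Hkl; induction t; cbn -[Nat.ltb]; rewrite ?and_true_iff, ?Nat.ltb_lt;
    intuition auto; lia.
Qed.

Lemma program_ok_snoc fuel env bs e e' : program_ok env bs ->
  check_entry fuel env e = Some e' ->
  exists b, program_ok (env ++ [e']) (bs ++ [b]).
Proof.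
  intros [H HF] E. unfold check_entry in E.
  apply bind_Some in E as ([T k] & ET & E).
  apply bind_Some in E as (b & Eb & E).
  destruct (if globs_below (length env) T then _ else false) eqn:Eg; [|discriminate].
  injection E as <-.
  apply and_true_iff in Eg as [g1 g2].
  eapply infer_type_ok in ET; eauto using ctx_ok_nil.
  eapply check_ok in Eb; eauto using ctx_ok_nil; [|eexists; eauto].
  exists (erase bs b).
  rewrite (Forall2_length H) in g1, g2. split.
  - apply Forall2_app.
    + clear - H HF. revert HF.
      generalize (entry_ok_app bs [erase bs b]).
      intros Happ HF. clear - Happ H HF.
      assert (Hall : forall l l', Forall2 (entry_ok bs) l l' ->
        Forall (fun e => globs_below (length bs) (e_type e) = true /\
                   globs_below (length bs) (e_body e) = true) l ->
        Forall2 (entry_ok (bs ++ [erase bs b])) l l').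
      { induction 1; intros HF'; constructor; inversion HF'; subst; intuition auto. }
      auto.
    + constructor; auto. apply entry_ok_app; auto.
      constructor; auto. eexists; eauto.
  - rewrite length_app. apply Forall_app; split.
    + eapply Forall_impl; [|exact HF]. cbn; intros a [? ?].
      split; (eapply globs_below_le; [|eassumption]; lia).
    + constructor; auto. cbn.
      split; (eapply globs_below_le; [|eassumption]; lia).
Qed.

Lemma check_program_ok fuel prog : forall env bs env', program_ok env bs ->
  check_program fuel env prog = Some env' -> exists bs', program_ok env' bs'.
Proof.
  induction prog as [|e prog IH]; intros env bs env' H E; cbn in E.
  - injection E as <-; eauto.
  - apply bind_Some in E as (e' & E1 & E).
    destruct (program_ok_snoc _ _ _ _ _ H E1) as [b Hb]. eauto.
Qed.

(** [T] is required to be unchanged by elaboration, so that the derivation found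
    is one for [T] itself. *)
Definition proves (fuel : nat) (prog : list entry) (t : src) (T : tm) : bool :=
  match (let* env := check_program fuel [] prog in
         let* (T', _) := infer_type env fuel [] (embed T) in
         if seqb T' (embed T) then check env fuel [] t T' else None) with
  | Some _ => true
  | None => false
  end.

Theorem proves_sound fuel prog t T :
  proves fuel prog t T = true -> exists u, typing nil u T.
Proof.
  unfold proves. destruct (let* _ := _ in _) as [u|] eqn:E; [|discriminate]. intros _.
  apply bind_Some in E as (env & Ep & E).
  destruct (check_program_ok _ _ [] [] env (conj (Forall2_nil _) (Forall_nil _)) Ep)
    as [bs [H _]].
  apply bind_Some in E as ([T' k] & ET & E).
  destruct (seqb T' _) eqn:Es; [|discriminate].
  eapply infer_type_ok in ET; eauto using ctx_ok_nil.
  eapply check_ok in E; eauto using ctx_ok_nil; [|eexists; eauto].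
  rewrite (seqb_erase _ _ _ Es), erase_embed in E. eauto.
Qed.

End Soundness.

Import Checker.

(** * Homotopy type theory in Rocq terms

    The definitions mirror the formal system: the eliminators compute on point
    constructors, path constructors and the computation rules for them are
    variables. Since all terms are checked again in the formal system, it does
    not matter that [merid] identifies distinct constructors of Rocq. Every proof
    is transparent and built from the eliminators below, never from [match]. *)

Module HoTT.
Close Scope hott_scope.

Definition U0 := Type.
Definition U1 := Type.
Definition U2 := Type.
(* These two definitions impose U0 < U1 < U2. *)
Definition U0_in_U1 : U1 := U0.
Definition U1_in_U2 : U2 := U1.

(** The sort [Set] lets an identity type live in every universe, so that Rocq
    does not have to relate the universe levels of identity types. *)
Inductive Id {A : Type} (a : A) : A -> Set := refl : Id a a.
Notation "x = y :> A" := (@Id A x y) : type_scope.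
Notation "x = y" := (Id x y) : type_scope.
Arguments refl {A a}, {A} a.

Inductive Sig (A : Type) (B : A -> Type) : Type := pair (a : A) (b : B a).
Arguments Sig {A} B.
Arguments pair {A} B a b.
Inductive Susp (A : U0) : Set := north | south.
Arguments north {A}.
Arguments south {A}.
Inductive EM (G : U0) (add : G -> G -> G) : Set := base.
Arguments EM {G} add.
Arguments base {G} add.
Inductive Tr (k : nat) (A : U0) : U0 := tr (a : A).
Arguments tr {k A} a.

Definition J {A : U2} (C : forall x y : A, x = y -> U2) (c : forall x, C x x refl)
  (x y : A) (p : x = y) : C x y p := match p with refl => c x end.
Definition SigInd {A : U2} {B : A -> U2} (C : Sig B -> U2)
  (h : forall a b, C (pair B a b)) (p : Sig B) : C p :=
  match p with pair _ a b => h a b end.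
Definition NatInd (C : nat -> U2) (z : C 0) (s : forall n, C n -> C (S n)) :
  forall n, C n :=
  fix F n := match n with 0 => z | S n => s n (F n) end.

(** ** Paths *)

Definition concat {A : U1} {x y z : A} (p : x = y) (q : y = z) : x = z :=
  J (fun x y _ => forall z, y = z -> x = z) (fun x z q => q) x y p z q.
Definition inv {A : U1} {x y : A} (p : x = y) : y = x :=
  J (fun x y _ => y = x) (fun x => refl) x y p.
Definition ap {A B : U1} (f : A -> B) {x y : A} (p : x = y) : f x = f y :=
  J (fun x y _ => f x = f y) (fun x => refl) x y p.
Definition transport {A : U1} (C : A -> U1) {x y : A} (p : x = y) (u : C x) : C y :=
  J (fun x y _ => C x -> C y) (fun x u => u) x y p u.
Definition IdOver {A : U1} (C : A -> U1) {x y : A} (p : x = y) (u : C x) (v : C y) : U1 :=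
  transport C p u = v.
Definition apd {A : U1} {C : A -> U1} (f : forall x, C x) {x y : A} (p : x = y) :
  IdOver C p (f x) (f y) :=
  J (fun x y p => IdOver C p (f x) (f y)) (fun x => refl) x y p.
Definition concatOver {A : U1} (C : A -> U1) {x y z : A} {p : x = y} {q : y = z}
  {u v w} (a : IdOver C p u v) (b : IdOver C q v w) : IdOver C (concat p q) u w :=
  J (fun x y p => forall (q : y = z) (u : C x) (v : C y),
       IdOver C p u v -> IdOver C q v w -> IdOver C (concat p q) u w)
    (fun x q u v a b => concat (ap (fun u => transport C q u) a) b)
    x y p q u v a b.
Definition IdOver2 {A : U1} (C : A -> U1) {x y : A} {u : C x} {v : C y} {p q : x = y}
  (r : p = q) (a : IdOver C p u v) (b : IdOver C q u v) : U1 :=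
  IdOver (fun p => IdOver C p u v) r a b.
Definition apd_concat {A : U1} {C : A -> U1} (f : forall x, C x) {x y z : A}
  (p : x = y) (q : y = z) :
  concatOver C (apd f p) (apd f q) = apd f (concat p q) :=
  J (fun x y p => forall q : y = z,
       concatOver C (apd f p) (apd f q) = apd f (concat p q))
    (fun x q => refl) x y p q.
Definition apd2 {A : U1} {C : A -> U1} (f : forall x, C x) {x y z : A}
  {p : x = y} {q : y = z} {p' : x = z} (r : concat p q = p') :
  IdOver2 C r (concatOver C (apd f p) (apd f q)) (apd f p') :=
  J (fun s t r => forall e : IdOver C s (f x) (f z), e = apd f s ->
       IdOver2 C r e (apd f t))
    (fun s e h => h) (concat p q) p' r
    (concatOver C (apd f p) (apd f q)) (apd_concat f p q).

(** Path induction with one endpoint fixed, from the two-sided [J] by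
    quantifying over the motive. *)
Definition PJ {A : U1} {a : A} (C : forall y, a = y -> U1) (c : C a refl)
  {y : A} (p : a = y) : C y p :=
  J (fun a y p => forall C : (forall y, a = y -> U1), C a refl -> C y p)
    (fun a C c => c) a y p C c.

Ltac path_ind p :=
  lazymatch type of p with Id ?x ?y => induction x, y, p using J end.
Ltac based_ind p :=
  lazymatch type of p with Id ?x ?y => induction y, p using (PJ (a := x)) end.
Ltac sig_ind p := induction p using SigInd.
Ltac nat_ind n := induction n using NatInd.

Definition fst {A : U1} {B : A -> U1} (p : Sig B) : A :=
  SigInd (fun _ => A) (fun a b => a) p.
Definition snd {A : U1} {B : A -> U1} (p : Sig B) : B (fst p) :=
  SigInd (fun p => B (fst p)) (fun a b => b) p.

Lemma concat_p1 {A : U1} {x y : A} (p : x = y) : concat p refl = p.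
Proof. path_ind p. exact refl. Defined.

Lemma concat_Vp {A : U1} {x y : A} (p : x = y) : concat (inv p) p = refl.
Proof. path_ind p. exact refl. Defined.

Lemma concat_pV {A : U1} {x y : A} (p : x = y) : concat p (inv p) = refl.
Proof. path_ind p. exact refl. Defined.

Lemma ap_concat {A B : U1} (f : A -> B) {x y z : A} (p : x = y) (q : y = z) :
  ap f (concat p q) = concat (ap f p) (ap f q).
Proof. path_ind p. exact refl. Defined.

Lemma transport_concat {A : U1} (C : A -> U1) {x y z : A} (p : x = y) (q : y = z) u :
  transport C (concat p q) u = transport C q (transport C p u).
Proof. path_ind p. exact refl. Defined.

Lemma transport_inv {A : U1} (C : A -> U1) {x y : A} (p : x = y) u v :
  transport C p u = v -> transport C (inv p) v = u.
Proof. path_ind p. exact (fun h => inv h). Defined.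

Lemma transport_ap {A B : U1} (C : B -> U1) (f : A -> B) {x y : A} (p : x = y) u :
  transport C (ap f p) u = transport (fun x => C (f x)) p u.
Proof. path_ind p. exact refl. Defined.

Lemma sig_path {A : U1} {B : A -> U1} {x y : A} (p : x = y) (b : B x) (b' : B y) :
  transport B p b = b' -> pair B x b = pair B y b'.
Proof. path_ind p. exact (fun q => ap (pair B x) q). Defined.

(** ** Truncation levels *)

Definition isContr (A : U1) : U1 := Sig (fun x : A => forall y, x = y).
Definition istrunc (k : nat) (A : U1) : U1 :=
  NatInd (fun _ => U1 -> U1) (fun A => isContr A)
    (fun _ P A => forall x y : A, P (x = y)) k A.
(** [istrunc] and [istrunc0] differ as terms of the formal system, because the
    motive of the recursion mentions a universe. *)
Definition istrunc0 (k : nat) (A : U0) : U0 :=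
  NatInd (fun _ => U0 -> U0) (fun A => Sig (fun x : A => forall y, x = y))
    (fun _ P A => forall x y : A, P (x = y)) k A.
Definition isprop (A : U1) : U1 := forall x y : A, x = y.
Definition isset (A : U1) : U1 := forall x y : A, isprop (x = y).

Lemma istrunc_raise k : forall A : U0, istrunc0 k A -> istrunc k A.
Proof.
  nat_ind k.
  - exact (fun A h => h).
  - exact (fun A h x y => IHk (x = y) (h x y)).
Defined.

Lemma contr_isprop {A : U1} : isContr A -> isprop A.
Proof.
  intros c x y. sig_ind c. exact (concat (inv (b x)) (b y)).
Defined.

Lemma contr_path {A : U1} (x : A) (h : forall y, x = y) (y z : A) : isContr (y = z).
Proof.
  refine (pair _ (concat (inv (h y)) (h z)) _).
  intros p. path_ind p. exact (concat_Vp (h x0)).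
Defined.

Lemma trunc_succ k : forall A : U1, istrunc k A -> istrunc (S k) A.
Proof.
  nat_ind k.
  - exact (fun A c => SigInd (fun _ => forall y z : A, isContr (y = z))
             (fun x h => contr_path x h) c).
  - exact (fun A h x y => IHk (x = y) (h x y)).
Defined.

Lemma trunc_id {k} {A : U1} (h : istrunc k A) (x y : A) : istrunc k (x = y).
Proof. exact (trunc_succ k A h x y). Defined.

Lemma prop_trunc1 {A : U1} (h : isprop A) : istrunc 1 A.
Proof. exact (fun x y => contr_path x (h x) x y). Defined.

Lemma trunc1_prop {A : U1} (h : istrunc 1 A) : isprop A.
Proof. exact (fun x y => fst (h x y)). Defined.

Lemma prop_trunc {A : U1} (h : isprop A) k : istrunc (S k) A.
Proof.
  nat_ind k.
  - exact (prop_trunc1 h).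
  - exact (trunc_succ (S k) A IHk).
Defined.

Lemma set_trunc {A : U1} (h : isset A) k : istrunc (S (S k)) A.
Proof. exact (fun x y => prop_trunc (h x y) k). Defined.

Lemma trunc_set {A : U1} (h : istrunc 2 A) : isset A.
Proof. exact (fun x y => trunc1_prop (h x y)). Defined.

Lemma prop_set {A : U1} (h : isprop A) : isset A.
Proof. exact (trunc_set (prop_trunc h 1)). Defined.

Lemma retract_path {A B : U1} (r : A -> B) (s : B -> A) (h : forall b, r (s b) = b)
  (x y : B) (p : x = y) :
  concat (inv (h x)) (concat (ap r (ap s p)) (h y)) = p.
Proof. path_ind p. exact (concat_Vp (h x)). Defined.

Lemma trunc_retract k : forall (A B : U1) (r : A -> B) (s : B -> A),
  (forall b, r (s b) = b) -> istrunc k A -> istrunc k B.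
Proof.
  nat_ind k.
  - intros A B r s h c. sig_ind c.
    exact (pair _ (r a) (fun y => concat (ap r (b (s y))) (h y))).
  - intros A B r s h t x y.
    exact (IHk (s x = s y) (x = y)
      (fun q => concat (inv (h x)) (concat (ap r q) (h y))) (fun p => ap s p)
      (retract_path r s h x y) (t (s x) (s y))).
Defined.

(** Any path [p] equals a path computed from a proof of [R x y] alone, and such
    proofs are unique. *)
Lemma set_of_relation {A : U1} (R : A -> A -> U1) (Rprop : forall x y, isprop (R x y))
  (rho : forall x, R x x) (f : forall x y, R x y -> x = y) : isset A.
Proof.
  assert (canonical : forall x y (p : x = y),
    concat (inv (f x x (rho x))) (f x y (transport (fun y => R x y) p (rho x))) = p).
  { intros x y p. path_ind p. exact (concat_Vp (f x x (rho x))). }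
  intros x y p q.
  exact (concat (inv (canonical x y p))
    (concat (ap (fun r => concat (inv (f x x (rho x))) (f x y r)) (Rprop x y _ _))
       (canonical x y q))).
Defined.

(** The path type of a sum is a retract of a sum of path types, which suffices
    to bound its truncation level. *)
Lemma path_sig {A : U1} {B : A -> U1} (u v : Sig B) (p : u = v) :
  Sig (fun p : fst u = fst v => transport B p (snd u) = snd v).
Proof. path_ind p. exact (pair _ refl refl). Defined.

Lemma sig_path' {A : U1} {B : A -> U1} (u v : Sig B) :
  Sig (fun p : fst u = fst v => transport B p (snd u) = snd v) -> u = v.
Proof.
  sig_ind u. sig_ind v. intros c. sig_ind c. exact (sig_path a1 b b0 b1).
Defined.

Lemma sig_path_retract {A : U1} {B : A -> U1} (u v : Sig B) (p : u = v) :
  sig_path' u v (path_sig u v p) = p.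
Proof. path_ind p. sig_ind x. exact refl. Defined.

Lemma trunc_sig_path k {A : U1} {B : A -> U1} (u v : Sig B) :
  istrunc k (Sig (fun p : fst u = fst v => transport B p (snd u) = snd v)) ->
  istrunc k (u = v).
Proof.
  exact (trunc_retract k _ _ (sig_path' u v) (path_sig u v) (sig_path_retract u v)).
Defined.

Lemma trunc_sig k : forall (A : U1) (B : A -> U1),
  istrunc k A -> (forall a, istrunc k (B a)) -> istrunc k (Sig B).
Proof.
  nat_ind k.
  - intros A B c h. sig_ind c.
    refine (pair _ (pair B a (fst (h a))) _).
    intros p. sig_ind p.
    exact (sig_path (b a0) _ _ (contr_isprop (h a0) _ _)).
  - intros A B t h u v. apply trunc_sig_path.
    exact (IHk _ _ (t (fst u) (fst v)) (fun p => h (fst v) _ _)).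
Defined.

Definition isequiv {A B : U1} (f : A -> B) : U1 :=
  Sig (fun _ : Sig (fun g : B -> A => forall y, f (g y) = y) =>
       Sig (fun h : B -> A => forall x, h (f x) = x)).
Definition equiv (A B : U1) : U1 := Sig (fun f : A -> B => isequiv f).
Definition mk_isequiv {A B : U1} (f : A -> B) (g : B -> A)
  (fg : forall y, f (g y) = y) (gf : forall x, g (f x) = x) : isequiv f :=
  pair _ (pair _ g fg) (pair _ g gf).
Definition idequiv (A : U1) : equiv A A :=
  pair _ (fun x => x) (mk_isequiv (fun x => x) (fun x => x) (fun x => refl) (fun x => refl)).
Definition idtoequiv {A B : U0} (p : A = B :> U0) : equiv A B :=
  J (A := U0) (fun (A B : U0) _ => equiv A B) (fun A => idequiv A) A B p.
Definition happly {A : U1} {B : A -> U1} {f g : forall x, B x} (p : f = g) :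
  forall x, f x = g x :=
  J (fun f g _ => forall x, f x = g x) (fun f x => refl) f g p.

(** ** Primitives *)

Section Primitives.

Variable funext_isequiv : forall (A : U1) (B : A -> U1) (f g : forall x, B x),
  isequiv (fun p : f = g => happly p).
Variable ua_isequiv : forall A B : U0, isequiv (fun p : A = B :> U0 => idtoequiv p).
Variable merid : forall {A : U0}, A -> @north A = south.
Variable loop : forall {G : U0} (add : G -> G -> G), G -> base add = base add.
Variable square : forall {G : U0} (add : G -> G -> G) (g h : G),
  concat (loop add g) (loop add h) = loop add (add g h).
Variable tr_level : forall (k : nat) (A : U0), istrunc0 k (Tr k A).

Definition SuspInd {A : U0} (C : Susp A -> U1) (n : C north) (s : C south)
  (m : forall a, IdOver C (merid a) n s) (x : Susp A) : C x :=
  match x with north => n | south => s end.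
Variable SuspIndMerid : forall {A : U0} (C : Susp A -> U1) (n : C north) (s : C south)
  (m : forall a, IdOver C (merid a) n s) (a : A),
  apd (SuspInd C n s m) (merid a) = m a.
Definition EM_loops {G : U0} (add : G -> G -> G) (C : EM add -> U1) (b : C (base add)) : U1 :=
  forall g, IdOver C (loop add g) b b.
Definition EM_squares {G : U0} (add : G -> G -> G) (C : EM add -> U1) (b : C (base add))
  (l : EM_loops add C b) : U1 :=
  forall g h, IdOver2 C (square add g h) (concatOver C (l g) (l h)) (l (add g h)).
Definition EMInd {G : U0} (add : G -> G -> G) (C : EM add -> U1) (b : C (base add))
  (l : EM_loops add C b) (s : EM_squares add C b l) (x : EM add) : C x :=
  match x with base _ => b end.
Variable EMIndPaths : forall {G : U0} (add : G -> G -> G) (C : EM add -> U1)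
  (b : C (base add)) (l : EM_loops add C b) (s : EM_squares add C b l),
  pair (fun l => EM_squares add C b l) (fun g => apd (EMInd add C b l s) (loop add g))
    (fun g h => apd2 (EMInd add C b l s) (square add g h))
  = pair (fun l => EM_squares add C b l) l s.
(** Two instances of the induction principle: [TrInd0], into types of the lowest
    universe, occurs in the definition of [sigma]; [TrInd] is also used to define
    families of types. *)
Definition TrInd0 {k : nat} {A : U0} (C : Tr k A -> U0)
  (h : forall x, istrunc0 k (C x)) (f : forall a, C (tr a)) (x : Tr k A) : C x :=
  match x with tr a => f a end.
Definition TrInd {k : nat} {A : U0} (C : Tr k A -> U1)
  (h : forall x, istrunc k (C x)) (f : forall a, C (tr a)) (x : Tr k A) : C x :=
  match x with tr a => f a end.

(** ** Function extensionality *)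

Definition funext {A : U1} {B : A -> U1} {f g : forall x, B x}
  (h : forall x, f x = g x) : f = g := fst (fst (funext_isequiv A B f g)) h.
Definition happly_funext {A : U1} {B : A -> U1} {f g : forall x, B x}
  (h : forall x, f x = g x) : happly (funext h) = h :=
  snd (fst (funext_isequiv A B f g)) h.

(** Homotopies can be treated like paths: a homotopy may be assumed constant. *)
Lemma htpy_ind {A : U1} {B : A -> U1} {f : forall x, B x}
  (C : forall g : (forall x, B x), (forall x, f x = g x) -> U1)
  (c : C f (fun x => refl)) (g : forall x, B x) (h : forall x, f x = g x) : C g h.
Proof.
  exact (transport (C g) (happly_funext h) (PJ (fun g p => C g (happly p)) c (funext h))).
Defined.

Lemma trunc_pi k : forall (A : U1) (B : A -> U1),
  (forall x, istrunc k (B x)) -> istrunc k (forall x, B x).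
Proof.
  nat_ind k.
  - intros A B h.
    exact (pair _ (fun x => fst (h x)) (fun f => funext (fun x => snd (h x) (f x)))).
  - intros A B h f g.
    exact (trunc_retract k (forall x, f x = g x) (f = g)
      (fst (snd (funext_isequiv A B f g))) (fun p => happly p)
      (snd (snd (funext_isequiv A B f g)))
      (IHk A (fun x => f x = g x) (fun x => h x (f x) (g x)))).
Defined.

Lemma isprop_istrunc k : forall A : U1, isprop (istrunc k A).
Proof.
  nat_ind k.
  - intros A c c'.
    assert (h : isset A) by exact (trunc_set (trunc_succ 1 A (trunc_succ 0 A c))).
    sig_ind c. sig_ind c'.
    exact (sig_path (b a0) b b0 (funext (fun y => h _ _ _ _))).
  - intros A h h'.
    exact (funext (fun x => funext (fun y => IHk (x = y) (h x y) (h' x y)))).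
Defined.

(** ** Univalence *)

Definition ua {A B : U0} (e : equiv A B) : A = B :> U0 :=
  fst (fst (ua_isequiv A B)) e.
Definition idtoequiv_ua {A B : U0} (e : equiv A B) : idtoequiv (ua e) = e :=
  snd (fst (ua_isequiv A B)) e.

Lemma ua_idtoequiv {A B : U0} (p : A = B :> U0) : ua (idtoequiv p) = p.
Proof.
  refine (concat (inv (snd (snd (ua_isequiv A B)) (ua (idtoequiv p)))) _).
  exact (concat (ap (fst (snd (ua_isequiv A B))) (idtoequiv_ua (idtoequiv p)))
           (snd (snd (ua_isequiv A B)) p)).
Defined.

Lemma trunc_equiv k (A B : U1) : istrunc k A -> istrunc k B -> istrunc k (equiv A B).
Proof.
  intros hA hB.
  refine (trunc_sig k _ _ (trunc_pi k A (fun _ => B) (fun _ => hB)) (fun f => _)).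
  refine (trunc_sig k _ _ _ (fun _ => _)).
  - exact (trunc_sig k _ _ (trunc_pi k B (fun _ => A) (fun _ => hA))
      (fun g => trunc_pi k B _ (fun y => trunc_id hB _ _))).
  - exact (trunc_sig k _ _ (trunc_pi k B (fun _ => A) (fun _ => hA))
      (fun g => trunc_pi k A _ (fun y => trunc_id hA _ _))).
Defined.

Lemma trunc_path_universe k (A B : U0) :
  istrunc k A -> istrunc k B -> istrunc k (A = B :> U0).
Proof.
  intros hA hB.
  exact (trunc_retract k (equiv A B) (A = B :> U0) (fun e => ua e)
    (fun p => idtoequiv p) (fun p => ua_idtoequiv p) (trunc_equiv k A B hA hB)).
Defined.

Definition NType (k : nat) : U1 := Sig (fun A : U0 => istrunc k A).
Definition El {k : nat} (X : NType k) : U0 := SigInd (fun _ => U0) (fun A h => A) X.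
Definition El_trunc {k : nat} (X : NType k) : istrunc k (El X) :=
  SigInd (fun X => istrunc k (El X)) (fun A h => h) X.

(** The truncation level is a proposition, so paths between truncated types are
    paths between types, that is equivalences. *)
Lemma trunc_NType k : istrunc (S k) (NType k).
Proof.
  intros X Y. apply trunc_sig_path.
  exact (trunc_sig k _ _ (trunc_path_universe k _ _ (El_trunc X) (El_trunc Y))
    (fun p => prop_trunc (isprop_istrunc k (El Y)) k _ _)).
Defined.

Lemma ntype_path {k} {X Y : NType k} : equiv (El X) (El Y) -> X = Y.
Proof.
  sig_ind X. sig_ind Y. intros e.
  exact (sig_path (ua e) b b0 (isprop_istrunc k a0 _ _)).
Defined.

Lemma transport_universe {A B : U0} (p : A = B :> U0) (x : A) :
  transport (fun A : U0 => A) p x = fst (idtoequiv p) x.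
Proof. path_ind p. exact refl. Defined.

Lemma transport_El_sig_path {k} {A B : U0} (p : A = B :> U0) (a : istrunc k A)
  (b : istrunc k B) (q : transport (fun A : U0 => istrunc k A) p a = b) (x : A) :
  transport (fun X : NType k => El X) (sig_path p a b q) x
  = transport (fun A : U0 => A) p x.
Proof. path_ind p. based_ind q. exact refl. Defined.

Lemma transport_ntype_path {k} {X Y : NType k} (e : equiv (El X) (El Y)) (x : El X) :
  transport (fun X : NType k => El X) (ntype_path e) x = fst e x.
Proof.
  sig_ind X. sig_ind Y.
  exact (concat (transport_El_sig_path (ua e) b b0 _ x)
    (concat (transport_universe (ua e) x)
      (ap (fun e => fst e x) (idtoequiv_ua e)))).
Defined.

Lemma contr_singleton {A : U1} (y : A) : isContr (Sig (fun x => x = y)).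
Proof.
  refine (pair _ (pair _ y refl) _). intros c. sig_ind c.
  path_ind b. exact refl.
Defined.

Lemma contr_isequiv_id (A : U1) : isContr (isequiv (fun x : A => x)).
Proof.
  assert (h : isContr (Sig (fun g : A -> A => forall y, g y = y))).
  { refine (trunc_retract 0 (forall y : A, Sig (fun x => x = y))
      (Sig (fun g : A -> A => forall y, g y = y))
      (fun F => pair (fun g : A -> A => forall y, g y = y)
                  (fun y => fst (F y)) (fun y => snd (F y)))
      (fun c y => pair (fun x => x = y) (fst c y) (snd c y)) _
      (trunc_pi 0 A _ (fun y => contr_singleton y))).
    intros c. sig_ind c. exact refl. }
  exact (trunc_sig 0 _ _ h (fun _ => h)).
Defined.

(** By univalence the equivalence may be assumed to be the identity map, for
    which both components of [isequiv] are contractible. *)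
Lemma isprop_isequiv {A B : U0} (f : A -> B) : isprop (isequiv f).
Proof.
  assert (h : forall e : equiv A B, isContr (isequiv (fst e))).
  { intros e. refine (transport (fun e => isContr (isequiv (fst e))) (idtoequiv_ua e) _).
    generalize (ua e). intros p. path_ind p. exact (contr_isequiv_id x). }
  intros e e'. exact (contr_isprop (h (pair _ f e)) e e').
Defined.

(** Paths between truncated types are determined by the functions that they
    induce. *)
Definition ntype_equiv {k} {X Y : NType k} (p : X = Y) : equiv (El X) (El Y) :=
  J (fun X Y _ => equiv (El X) (El Y)) (fun X => idequiv (El X)) X Y p.

Lemma ntype_equiv_transport {k} {X Y : NType k} (p : X = Y) (x : El X) :
  fst (ntype_equiv p) x = transport (fun X => El X) p x.
Proof. path_ind p. exact refl. Defined.

Lemma sig_path_refl {A : U1} {B : A -> U1} (h : forall x, isprop (B x)) (x : A)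
  (p : x = x) (b : B x) (q : transport B p b = b) :
  refl = p -> sig_path p b b q = refl.
Proof.
  intros e. based_ind e.
  exact (ap (fun q => sig_path refl b b q) (prop_set (h x) b b q refl)).
Defined.

Lemma ntype_path_equiv {k} {X Y : NType k} (p : X = Y) : ntype_path (ntype_equiv p) = p.
Proof.
  path_ind p. sig_ind x.
  exact (sig_path_refl (A := U0) (B := fun A : U0 => istrunc k A)
    (fun A : U0 => isprop_istrunc k A) a _ b _
    (inv (ua_idtoequiv refl))).
Defined.

Lemma ntype_path_unique {k} {X Y : NType k} (p q : X = Y) :
  (forall x, transport (fun X => El X) p x = transport (fun X => El X) q x) -> p = q.
Proof.
  intros h.
  assert (e : ntype_equiv p = ntype_equiv q).
  { refine (sig_path' _ _ (pair _ (funext (fun x => _)) (isprop_isequiv _ _ _))).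
    exact (concat (ntype_equiv_transport p x)
      (concat (h x) (inv (ntype_equiv_transport q x)))). }
  exact (concat (inv (ntype_path_equiv p))
    (concat (ap (fun e => ntype_path e) e) (ntype_path_equiv q))).
Defined.

(** ** Recursion on suspensions and Eilenberg-MacLane spaces *)

(** Paths over [p] in a constant family are paths; the next lemmas make the
    dependent eliminators into recursion principles. *)
Lemma constOver {A B : U1} {x y : A} (p : x = y) {u v : B} :
  u = v -> IdOver (fun _ : A => B) p u v.
Proof. path_ind p. exact (fun l => l). Defined.

Lemma constOver_inj {A B : U1} {x y : A} (p : x = y) {u v : B} (l l' : u = v) :
  constOver p l = constOver p l' -> l = l'.
Proof. path_ind p. exact (fun h => h). Defined.

Lemma apd_const {A B : U1} (f : A -> B) {x y : A} (p : x = y) :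
  apd (C := fun _ => B) f p = constOver p (ap f p).
Proof. path_ind p. exact refl. Defined.

Lemma concatOver_const {A B : U1} {x y z : A} (p : x = y) (q : y = z) {u v w : B}
  (l : u = v) (l' : v = w) :
  concatOver (fun _ : A => B) (constOver p l) (constOver q l')
  = constOver (concat p q) (concat l l').
Proof. path_ind p. path_ind q. path_ind l. exact refl. Defined.

Lemma IdOver2_const {A B : U1} {x y : A} {p q : x = y} (r : p = q) {u v : B}
  (l l' : u = v) (a : IdOver (fun _ : A => B) p u v) :
  a = constOver p l -> l = l' -> IdOver2 (fun _ : A => B) r a (constOver q l').
Proof.
  path_ind r. intros e e'. exact (concat e (ap (fun l => constOver x0 l) e')).
Defined.

Definition susp_rec {A : U0} {D : U1} (n s : D) (m : A -> n = s) : Susp A -> D :=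
  SuspInd (fun _ => D) n s (fun a => constOver (merid a) (m a)).

Lemma susp_rec_merid {A : U0} {D : U1} (n s : D) (m : A -> n = s) (a : A) :
  ap (susp_rec n s m) (merid a) = m a.
Proof.
  exact (constOver_inj (merid a) _ _
    (concat (inv (apd_const (susp_rec n s m) (merid a)))
       (SuspIndMerid _ _ _ _ a))).
Defined.

Definition em_rec {G : U0} (add : G -> G -> G) {D : U1} (b : D) (l : G -> b = b)
  (s : forall g h, concat (l g) (l h) = l (add g h)) : EM add -> D :=
  EMInd add (fun _ => D) b (fun g => constOver (loop add g) (l g))
    (fun g h => IdOver2_const (square add g h) (concat (l g) (l h)) (l (add g h)) _
       (concatOver_const (loop add g) (loop add h) (l g) (l h)) (s g h)).

Lemma em_rec_loop {G : U0} (add : G -> G -> G) {D : U1} (b : D) (l : G -> b = b)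
  (s : forall g h, concat (l g) (l h) = l (add g h)) (g : G) :
  ap (em_rec add b l s) (loop add g) = l g.
Proof.
  exact (constOver_inj (loop add g) _ _
    (concat (inv (apd_const (em_rec add b l s) (loop add g)))
       (happly (ap (fun c => fst c) (EMIndPaths add (fun _ => D) b _ _)) g))).
Defined.

(** Into sets, nothing needs to be checked over [square]. *)
Lemma EM_ind_set {G : U0} (add : G -> G -> G) (C : EM add -> U1)
  (h : forall x, istrunc 2 (C x)) (b : C (base add)) (l : EM_loops add C b) :
  forall x, C x.
Proof.
  exact (EMInd add C b l (fun g k => trunc_set (h (base add)) _ _ _ _)).
Defined.

(** ** Eilenberg-MacLane spaces *)

Definition lev (m : nat) : nat := S (S (S m)).
Definition rawK {G : U0} (add : G -> G -> G) (m : nat) : U0 :=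
  NatInd (fun _ => U0) (EM add) (fun _ X => Susp X) m.
Definition rawK_pt {G : U0} (add : G -> G -> G) (m : nat) : rawK add m :=
  NatInd (fun m => rawK add m) (base add) (fun m _ => @north (rawK add m)) m.
Definition K {G : U0} (add : G -> G -> G) (n : nat) : U0 :=
  NatInd (fun _ => U0) G (fun m _ => Tr (lev m) (rawK add m)) n.
Definition K_pt {G : U0} (add : G -> G -> G) (z : G) (n : nat) : K add n :=
  NatInd (fun n => K add n) z (fun m _ => @tr (lev m) (rawK add m) (rawK_pt add m)) n.
Definition LoopK {G : U0} (add : G -> G -> G) (z : G) (n : nat) : U0 :=
  K_pt add z (S n) = K_pt add z (S n).
Definition trK {G : U0} (add : G -> G -> G) (m : nat) (x : rawK add m) : K add (S m) :=
  @tr (lev m) (rawK add m) x.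
Definition ap_tr {G : U0} (add : G -> G -> G) (m : nat) {x y : rawK add m} (p : x = y) :
  trK add m x = trK add m y :=
  ap (fun x : rawK add m => trK add m x) p.
Definition northK {G : U0} (add : G -> G -> G) (m : nat) : rawK add (S m) :=
  @north (rawK add m).
Definition southK {G : U0} (add : G -> G -> G) (m : nat) : rawK add (S m) :=
  @south (rawK add m).
Definition meridK {G : U0} (add : G -> G -> G) (m : nat) (a : rawK add m) :
  northK add m = southK add m := merid (A := rawK add m) a.
Definition rawK_ind {G : U0} (add : G -> G -> G) (m : nat) (P : rawK add (S m) -> U1)
  (n : P (northK add m)) (s : P (southK add m))
  (h : forall a : rawK add m, IdOver P (meridK add m a) n s) (x : rawK add (S m)) : P x :=
  SuspInd (A := rawK add m) P n s h x.
Definition raw_sigma {G : U0} (add : G -> G -> G) (z : G) (m : nat) (x : rawK add m) :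
  LoopK add z (S m) :=
  ap_tr add (S m) (concat (meridK add m x) (inv (meridK add m (rawK_pt add m)))).
Definition LoopK_level {G : U0} (add : G -> G -> G) (z : G) (m : nat) :
  istrunc0 (lev m) (LoopK add z (S m)) :=
  tr_level (lev (S m)) (rawK add (S m)) (K_pt add z (S (S m))) (K_pt add z (S (S m))).
Definition sigma {G : U0} (add : G -> G -> G) (z : G) (n : nat) : K add n -> LoopK add z n :=
  NatInd (fun n => K add n -> LoopK add z n)
    (fun g => ap_tr add 0 (loop add g))
    (fun m _ (x : K add (S m)) =>
       TrInd0 (fun _ : K add (S m) => LoopK add z (S m))
         (fun _ : K add (S m) => LoopK_level add z m)
         (fun a => raw_sigma add z m a) x)
    n.

Lemma Tr_trunc k (A : U0) : istrunc k (Tr k A).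
Proof. exact (istrunc_raise k _ (tr_level k A)). Defined.

(** ** The case of degree zero *)

Lemma isequiv_homotopic {A B : U1} (f g : A -> B) (h : forall x, f x = g x) :
  isequiv f -> isequiv g.
Proof. exact (fun e => transport (fun f => isequiv f) (funext h) e). Defined.

(** A path in the family [x |-> (C x -> a = f x)] amounts to a compatibility
    with concatenation. *)
Lemma transport_loops {A B : U1} (f : A -> B) {C : A -> U1} (a : B) {x y : A} (p : x = y)
  (s : C x -> a = f x) (t : C y -> a = f y) :
  (forall c, concat (s c) (ap f p) = t (transport C p c)) ->
  IdOver (fun x => C x -> a = f x) p s t.
Proof.
  path_ind p. intros h.
  exact (funext (fun c => concat (inv (concat_p1 (s c))) (h c))).
Defined.

(** The inverse of [s] is [p |-> transport C p c]. It is a left inverse by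
    [encode]; that it is a right inverse is a statement about [decode x] for all
    [x] and all paths [a = x], hence follows by path induction. *)
Lemma encode_decode {B : U1} (a : B) (C : B -> U1) (c : C a)
  (decode : forall x, C x -> a = x) (s : C a -> a = a)
  (hs : forall u, decode a u = s u) (s0 : s c = refl)
  (encode : forall u, transport C (s u) c = u) : isequiv s.
Proof.
  assert (h : forall x (p : a = x), decode x (transport C p c) = p).
  { intros x p. based_ind p. exact (concat (hs c) s0). }
  exact (mk_isequiv s (fun p => transport C p c)
    (fun p => concat (inv (hs _)) (h a p)) encode).
Defined.

(** In a family defined by recursion and univalence, transport along a generating
    path is the chosen equivalence. *)
Lemma transport_code {A : U1} {k} (c : A -> NType k) {x y : A} (p : x = y)
  (e : equiv (El (c x)) (El (c y))) (h : ap c p = ntype_path e) (u : El (c x)) :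
  transport (fun x => El (c x)) p u = fst e u.
Proof.
  exact (concat (inv (transport_ap (fun X => El X) c p u))
    (concat (ap (fun q => transport (fun X => El X) q u) h)
       (transport_ntype_path e u))).
Defined.

Lemma concat_V_pp {A : U1} {x y z : A} (p : x = y) (q : y = z) :
  concat (inv p) (concat p q) = q.
Proof. path_ind p. exact refl. Defined.

(** Used for the loop of the neutral element, which is idempotent by [square]. *)
Lemma idempotent_path {A : U1} {x : A} (p : x = x) : concat p p = p -> p = refl.
Proof.
  exact (fun h => concat (inv (concat_V_pp p p))
    (concat (ap (fun q => concat (inv p) q) h) (concat_Vp p))).
Defined.

Section DegreeZero.

Variables (G : U0) (setG : isset G) (add : G -> G -> G) (z : G) (neg : G -> G).
Variable addA : forall x y w, add x (add y w) = add (add x y) w.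
Variable addz : forall x, add x z = x.
Variable addN : forall x, add x (neg x) = z.
Variable addC : forall x y, add x y = add y x.

Definition translation (g : G) : equiv G G.
Proof.
  refine (pair _ (fun x => add x g) (mk_isequiv _ (fun x => add x (neg g)) _ _)).
  - exact (fun x => concat (inv (addA x (neg g) g))
      (concat (ap (fun y => add x y) (concat (addC (neg g) g) (addN g))) (addz x))).
  - exact (fun x => concat (inv (addA x g (neg g)))
      (concat (ap (fun y => add x y) (addN g)) (addz x))).
Defined.

Definition G_ntype : NType 2 := pair (fun A : U0 => istrunc 2 A) G (set_trunc setG 0).
Definition translation_path (g : G) : G_ntype = G_ntype :=
  ntype_path (X := G_ntype) (Y := G_ntype) (translation g).

Lemma translation_path_add (g h : G) :
  concat (translation_path g) (translation_path h) = translation_path (add g h).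
Proof.
  refine (ntype_path_unique _ _ (fun x => _)).
  refine (concat (transport_concat _ (translation_path g) (translation_path h) x) _).
  refine (concat (ap (fun u => transport (fun X => El X) (translation_path h) u)
    (transport_ntype_path (X := G_ntype) (Y := G_ntype) (translation g) x)) _).
  refine (concat (transport_ntype_path (X := G_ntype) (Y := G_ntype) (translation h) _) _).
  refine (concat (inv (addA x g h)) _).
  exact (inv (transport_ntype_path (X := G_ntype) (Y := G_ntype) (translation (add g h)) x)).
Defined.

Definition raw_code0 : EM add -> NType 2 :=
  em_rec add G_ntype translation_path translation_path_add.
Definition code0 : K add 1 -> NType 2 :=
  TrInd (k := 3) (fun _ => NType 2) (fun _ => trunc_NType 2) raw_code0.

Lemma transport_code0 (g u : G) :
  transport (fun x => El (raw_code0 x)) (loop add g) u = add u g.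
Proof.
  exact (transport_code raw_code0 (loop add g) (translation g)
    (em_rec_loop add G_ntype translation_path translation_path_add g) u).
Defined.

Lemma sigma0_add (g h : G) :
  concat (sigma add z 0 g) (ap_tr add 0 (loop add h)) = sigma add z 0 (add g h).
Proof.
  exact (concat (inv (ap_concat (fun x : EM add => trK add 0 x) (loop add g) (loop add h)))
    (ap (fun p => ap_tr add 0 p) (square add g h))).
Defined.

Definition decode0 : forall x : K add 1, El (code0 x) -> trK add 0 (base add) = x.
Proof.
  refine (TrInd (k := 3) (fun x => El (code0 x) -> trK add 0 (base add) = x)
    (fun x => trunc_pi 3 _ _ (fun _ => trunc_id (Tr_trunc 3 (EM add)) _ _)) _).
  refine (EM_ind_set add
    (fun x => El (raw_code0 x) -> trK add 0 (base add) = trK add 0 x)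
    (fun x => trunc_pi 2 _ _ (fun _ => Tr_trunc 3 (EM add) _ _))
    (sigma add z 0) (fun g => _)).
  refine (transport_loops (fun x : EM add => trK add 0 x) (C := fun x => El (raw_code0 x))
    (trK add 0 (base add)) (loop add g) _ _ (fun c => _)).
  exact (concat (sigma0_add c g)
    (ap (fun u => sigma add z 0 u) (inv (transport_code0 g c)))).
Defined.

Theorem isequiv_sigma0 : isequiv (sigma add z 0).
Proof.
  refine (encode_decode (trK add 0 (base add)) (fun x => El (code0 x)) z decode0
    (sigma add z 0) (fun u => refl) _ (fun u => _)).
  - exact (ap (fun p => ap_tr add 0 p) (idempotent_path (loop add z)
      (concat (square add z z) (ap (fun g => loop add g) (addz z))))).
  - refine (concat (transport_ap (fun x => El (code0 x)) (fun x : EM add => trK add 0 x)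
      (loop add u) z) _).
    exact (concat (transport_code0 u z) (concat (addC z u) (addz u))).
Defined.

End DegreeZero.

(** ** Connectedness *)

(** The value at [south] is the transport of [u] along the meridian of the base
    point. That the other meridians agree with this one is a family of paths,
    hence of types one level lower, over the preceding space. *)
Lemma conn {G : U0} (add : G -> G -> G) m : forall P : rawK add m -> U1,
  (forall x, istrunc (S m) (P x)) -> forall u : P (rawK_pt add m),
  Sig (fun f : forall x, P x => f (rawK_pt add m) = u).
Proof.
  nat_ind m.
  - exact (fun P h u => pair (fun f : forall x, P x => f (base add) = u)
      (EM_ind_set add P (fun x => trunc_succ 1 _ (h x)) u
        (fun g => trunc1_prop (h (base add)) _ _)) refl).
  - intros P h u.
    refine (pair (fun f : forall x, P x => f (northK add m) = u)
      (rawK_ind add m P u (transport P (meridK add m (rawK_pt add m)) u)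
        (fun a : rawK add m => _)) refl).
    exact (fst (IHm
      (fun a : rawK add m =>
         transport P (meridK add m a) u = transport P (meridK add m (rawK_pt add m)) u)
      (fun a : rawK add m => h (southK add m) _ _) refl) a).
Defined.

(** The homotopy may be assumed constant, and then only the two paths at the base
    point have to be compared. *)
Lemma pointed_path {X : U1} {P : X -> U1} (x0 : X) {u : P x0} (f g : forall x, P x)
  (h : forall x, f x = g x) (p : f x0 = u) (q : g x0 = u) :
  h x0 = concat p (inv q) ->
  pair (fun f : forall x, P x => f x0 = u) f p = pair (fun f => f x0 = u) g q.
Proof.
  refine (htpy_ind (fun g h => forall q : g x0 = u, h x0 = concat p (inv q) ->
    pair (fun f : forall x, P x => f x0 = u) f p = pair (fun f => f x0 = u) g q)
    _ g h q).
  clear g h q. intros q e. based_ind q.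
  exact (ap (fun p => pair (fun f' : forall x, P x => f' x0 = f x0) f p)
    (inv (concat e (concat_p1 p)))).
Defined.

Section Evaluation.

Variables (G : U0) (add : G -> G -> G) (m : nat) (P : rawK add m -> U1).

(** Two sections that agree at the base point are homotopic by [conn], since the
    paths between them are one level lower. *)
Lemma isprop_extensions (h : forall x, istrunc (S (S m)) (P x)) (u : P (rawK_pt add m)) :
  isprop (Sig (fun f : forall x, P x => f (rawK_pt add m) = u)).
Proof.
  intros c d. sig_ind c. sig_ind d.
  pose (k := conn add m (fun x => a x = a0 x) (fun x => h x _ _) (concat b (inv b0))).
  exact (pointed_path (rawK_pt add m) a a0 (fst k) b b0 (snd k)).
Defined.

End Evaluation.

(** Pointed homotopies form a proposition, by [isprop_extensions] for the family
    of paths. *)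
Lemma isset_extensions {G : U0} (add : G -> G -> G) (m : nat) (P : rawK add m -> U1)
  (h : forall x, istrunc (S (S (S m))) (P x)) (u : P (rawK_pt add m)) :
  isset (Sig (fun f : forall x, P x => f (rawK_pt add m) = u)).
Proof.
  refine (set_of_relation
    (fun c d : Sig (fun f : forall x, P x => f (rawK_pt add m) = u) =>
       Sig (fun k : forall x, fst c x = fst d x =>
       k (rawK_pt add m) = concat (snd c) (inv (snd d))))
    (fun c d : Sig (fun f : forall x, P x => f (rawK_pt add m) = u) =>
       isprop_extensions G add m (fun x => fst c x = fst d x)
       (fun x => h x (fst c x) (fst d x)) (concat (snd c) (inv (snd d)))) _ _).
  - exact (fun c => pair _ (fun x => refl) (inv (concat_pV (snd c)))).
  - intros c d k. sig_ind c. sig_ind d.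
    exact (pointed_path (rawK_pt add m) a a0 (fst k) b b0 (snd k)).
Defined.

(** ** Multiplication *)

(** The candidates for translation by [a]. *)
Definition pointed_map {G : U0} (add : G -> G -> G) (m : nat) (a : rawK add m) : U0 :=
  Sig (fun f : rawK add m -> K add (S m) => f (rawK_pt add m) = trK add m a).
Definition unit_map {G : U0} (add : G -> G -> G) (m : nat) :
  pointed_map add m (rawK_pt add m) :=
  pair _ (fun x : rawK add m => trK add m x) refl.

Lemma isset_pointed_map {G : U0} (add : G -> G -> G) m a : isset (pointed_map add m a).
Proof.
  exact (isset_extensions add m (fun _ => K add (S m))
    (fun _ => Tr_trunc (lev m) (rawK add m)) (trK add m a)).
Defined.

Lemma transport_pointed {X Y : U1} (g : X -> Y) (x0 : X) {a b : X} (p : a = b)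
  (f : X -> Y) (q : f x0 = g a) :
  transport (fun a => Sig (fun f : X -> Y => f x0 = g a)) p (pair _ f q)
  = pair _ f (concat q (ap g p)).
Proof.
  path_ind p.
  exact (ap (fun q => pair (fun f : X -> Y => f x0 = g x) f q) (inv (concat_p1 q))).
Defined.

Lemma conj_over {A B : U1} (f : A -> B) {x y : A} (p : x = y) (b : f x = f x)
  (b' : f y = f y) : concat b (ap f p) = concat (ap f p) b' ->
  IdOver (fun x => f x = f x) p b b'.
Proof. path_ind p. exact (fun h => concat (inv (concat_p1 b)) h). Defined.

Lemma loops_commute {G : U0} (add : G -> G -> G) (addC : forall x y, add x y = add y x)
  (g h : G) :
  concat (ap_tr add 0 (loop add g)) (ap_tr add 0 (loop add h))
  = concat (ap_tr add 0 (loop add h)) (ap_tr add 0 (loop add g)).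
Proof.
  refine (concat (inv (ap_concat (fun x : EM add => trK add 0 x) (loop add g) (loop add h))) _).
  refine (concat _ (ap_concat (fun x : EM add => trK add 0 x) (loop add h) (loop add g))).
  refine (ap (fun p => ap_tr add 0 p) _).
  exact (concat (square add g h) (concat (ap (fun g => loop add g) (addC g h))
    (inv (square add h g)))).
Defined.

(** A loop of the base point extends to a homotopy from the canonical map to
    itself if it commutes with all loops. *)
Lemma loop_homotopy {G : U0} (add : G -> G -> G) (addC : forall x y, add x y = add y x)
  (g : G) : forall x : EM add, trK add 0 x = trK add 0 x.
Proof.
  exact (EM_ind_set add (fun x => trK add 0 x = trK add 0 x)
    (fun x => Tr_trunc 3 (EM add) _ _) (ap_tr add 0 (loop add g))
    (fun h => conj_over (fun x : EM add => trK add 0 x) (loop add h) _ _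
       (loops_commute add addC g h))).
Defined.

(** For [m > 0] sets are (m-1)-types, so [conn] applies. For [m = 0] the
    canonical map has to be transported along the loops explicitly; its image
    is the canonical map with another path at the base point. *)
Lemma multiplication {G : U0} (add : G -> G -> G) (addC : forall x y, add x y = add y x) m :
  Sig (fun M : forall a, pointed_map add m a => M (rawK_pt add m) = unit_map add m).
Proof.
  nat_ind m.
  - refine (pair (fun M : forall a, pointed_map add 0 a => M (base add) = unit_map add 0)
      (EM_ind_set add (fun a => pointed_map add 0 a)
        (fun a => set_trunc (isset_pointed_map add 0 a) 0) (unit_map add 0) (fun g => _)) refl).
    refine (concat (transport_pointed (fun x : EM add => trK add 0 x) (base add) (loop add g)
      (fun x : EM add => trK add 0 x) refl) _).
    exact (pointed_path (base add) (fun x : EM add => trK add 0 x) (fun x : EM add => trK add 0 x)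
      (loop_homotopy add addC g) (ap_tr add 0 (loop add g)) refl (inv (concat_p1 _))).
  - exact (conn add (S m) (fun a => pointed_map add (S m) a)
      (fun a => set_trunc (isset_pointed_map add (S m) a) m) (unit_map add (S m))).
Defined.

(** ** The case of positive degree *)

(** Both sides are [ap f p] up to cancellation of [r]. The proof is by induction
    on [r] so that the path becomes trivial for [p = r]. *)
Lemma sigma_coherence {A B : U1} (f : A -> B) {x y : A} (r p : x = y) :
  concat (ap f (concat r (inv r))) (ap f p) = concat (ap f (concat p (inv r))) (ap f r).
Proof.
  path_ind r.
  exact (inv (concat (concat_p1 _) (ap (fun p => ap f p) (concat_p1 p)))).
Defined.

Lemma sigma_coherence_diag {A B : U1} (f : A -> B) {x y : A} (r : x = y) :
  sigma_coherence f r r = refl.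
Proof. path_ind r. exact refl. Defined.

Section PositiveDegree.

Variables (G : U0) (add : G -> G -> G) (z : G) (m : nat).
Variable M : forall a, pointed_map add m a.
Variable M_unit : M (rawK_pt add m) = unit_map add m.

Definition mul (a : rawK add m) : K add (S m) -> K add (S m) :=
  TrInd (k := lev m) (fun _ => K add (S m)) (fun _ => Tr_trunc (lev m) (rawK add m))
    (fst (M a)).

Lemma mul_unit (y : K add (S m)) : y = mul (rawK_pt add m) y.
Proof.
  exact (TrInd (k := lev m) (fun y => y = mul (rawK_pt add m) y)
    (fun y => trunc_id (Tr_trunc (lev m) (rawK add m)) _ _)
    (fun x => inv (happly (ap (fun c => fst c) M_unit) x)) y).
Defined.

Lemma isequiv_mul (a : rawK add m) : isequiv (mul a).
Proof.
  exact (fst (conn add m (fun a => isequiv (mul a))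
    (fun a => prop_trunc (isprop_isequiv (mul a)) m)
    (isequiv_homotopic (fun y => y) (mul (rawK_pt add m)) mul_unit
       (snd (idequiv (K add (S m)))))) a).
Defined.

Definition K_ntype : NType (lev m) :=
  pair (fun A : U0 => istrunc (lev m) A) (K add (S m)) (Tr_trunc (lev m) (rawK add m)).
Definition mul_path (a : rawK add m) : K_ntype = K_ntype :=
  ntype_path (X := K_ntype) (Y := K_ntype) (pair _ (mul a) (isequiv_mul a)).
Definition raw_code : rawK add (S m) -> NType (lev m) :=
  susp_rec K_ntype K_ntype mul_path.
Definition code : K add (S (S m)) -> NType (lev m) :=
  TrInd (k := lev (S m)) (fun _ => NType (lev m)) (fun _ => trunc_NType (lev m)) raw_code.

Lemma transport_raw_code (a : rawK add m) (y : K add (S m)) :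
  transport (fun x => El (raw_code x)) (meridK add m a) y = mul a y.
Proof.
  exact (transport_code raw_code (meridK add m a) (pair _ (mul a) (isequiv_mul a))
    (susp_rec_merid K_ntype K_ntype mul_path a) y).
Defined.

Definition tr_merid (a : rawK add m) :
  trK add (S m) (northK add m) = trK add (S m) (southK add m) :=
  ap_tr add (S m) (meridK add m a).

(** Additivity of [sigma]. It is stated for an arbitrary candidate [c] in place
    of the chosen translation [M a], in order that [M 0] can be replaced by
    [unit_map]; for the latter it holds by computation. *)
Definition hom_at (a : rawK add m) (c : pointed_map add m a) (x : rawK add m) : U0 :=
  concat (raw_sigma add z m x) (tr_merid a)
  = concat (sigma add z (S m) (fst c x)) (tr_merid (rawK_pt add m)).

Definition hom_at_pt (a : rawK add m) (c : pointed_map add m a) :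
  hom_at a c (rawK_pt add m) :=
  concat (sigma_coherence (fun x : rawK add (S m) => trK add (S m) x)
            (meridK add m (rawK_pt add m)) (meridK add m a))
    (ap (fun y => concat (sigma add z (S m) y) (tr_merid (rawK_pt add m))) (inv (snd c))).

Definition hom_extension (a : rawK add m) (c : pointed_map add m a) : U0 :=
  Sig (fun h : forall x, hom_at a c x => h (rawK_pt add m) = hom_at_pt a c).

Lemma hom_extension_unit : hom_extension (rawK_pt add m) (unit_map add m).
Proof.
  refine (pair _ (fun x => refl) _).
  exact (inv (concat (concat_p1 _) (sigma_coherence_diag
    (fun x : rawK add (S m) => trK add (S m) x) (meridK add m (rawK_pt add m))))).
Defined.

(** For each [a] the pointed proofs of additivity form a proposition, because
    they are sections of a family of m-types. *)
Lemma sigma_hom (a x : rawK add m) : hom_at a (M a) x.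
Proof.
  exact (fst (fst (conn add m (fun a => hom_extension a (M a))
    (fun a => prop_trunc (isprop_extensions G add m (fun x => hom_at a (M a) x)
       (fun x => Tr_trunc (lev (S m)) (rawK add (S m)) _ _ _ _) _) m)
    (transport (fun c => hom_extension (rawK_pt add m) c) (inv M_unit)
       hom_extension_unit)) a) x).
Defined.

Lemma sigma_transport (a : rawK add m) (y : K add (S m)) :
  concat (sigma add z (S m) y) (tr_merid a)
  = concat (sigma add z (S m) (transport (fun x => El (raw_code x)) (meridK add m a) y))
      (tr_merid (rawK_pt add m)).
Proof.
  exact (concat
    (TrInd (k := lev m) (fun y => concat (sigma add z (S m) y) (tr_merid a)
        = concat (sigma add z (S m) (mul a y)) (tr_merid (rawK_pt add m)))
      (fun y => trunc_id (k := lev m)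
         (A := trK add (S m) (northK add m) = trK add (S m) (southK add m))
         (Tr_trunc (lev (S m)) (rawK add (S m)) _ _) _ _)
      (fun x => sigma_hom a x) y)
    (ap (fun w => concat (sigma add z (S m) w) (tr_merid (rawK_pt add m)))
      (inv (transport_raw_code a y)))).
Defined.

Definition decode : forall x : K add (S (S m)),
  El (code x) -> trK add (S m) (northK add m) = x.
Proof.
  refine (TrInd (k := lev (S m))
    (fun x => El (code x) -> trK add (S m) (northK add m) = x)
    (fun x => trunc_pi (lev (S m)) _ _
       (fun _ => trunc_id (Tr_trunc (lev (S m)) (rawK add (S m))) _ _)) _).
  refine (rawK_ind add m (fun x : rawK add (S m) => El (raw_code x) ->
      trK add (S m) (northK add m) = trK add (S m) x)
    (sigma add z (S m))
    (fun y => concat (sigma add z (S m) y) (tr_merid (rawK_pt add m)))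
    (fun a : rawK add m => _)).
  exact (transport_loops (fun x : rawK add (S m) => trK add (S m) x)
    (C := fun x => El (raw_code x)) (trK add (S m) (northK add m)) (meridK add m a)
    _ _ (sigma_transport a)).
Defined.

Lemma encode_sigma (x : rawK add m) :
  transport (fun x => El (code x)) (raw_sigma add z m x) (trK add m (rawK_pt add m))
  = trK add m x.
Proof.
  refine (concat (transport_ap (fun x => El (code x))
    (fun x : rawK add (S m) => trK add (S m) x) _ _) _).
  refine (concat (transport_concat (fun x => El (raw_code x)) (meridK add m x)
    (inv (meridK add m (rawK_pt add m))) _) _).
  refine (concat (ap (fun u => transport (fun x => El (raw_code x))
      (inv (meridK add m (rawK_pt add m))) u)
    (concat (transport_raw_code x (trK add m (rawK_pt add m))) (snd (M x)))) _).
  exact (transport_inv (fun x => El (raw_code x)) (meridK add m (rawK_pt add m)) _ _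
    (concat (transport_raw_code (rawK_pt add m) _) (inv (mul_unit (trK add m x))))).
Defined.

Theorem isequiv_sigma_pos : isequiv (sigma add z (S m)).
Proof.
  refine (encode_decode (trK add (S m) (northK add m)) (fun x => El (code x))
    (trK add m (rawK_pt add m)) decode (sigma add z (S m)) (fun u => refl) _ _).
  - exact (ap (fun p => ap_tr add (S m) p) (concat_pV (meridK add m (rawK_pt add m)))).
  - exact (TrInd (k := lev m)
      (fun u => transport (fun x => El (code x)) (sigma add z (S m) u)
          (trK add m (rawK_pt add m)) = u)
      (fun u => trunc_id (Tr_trunc (lev m) (rawK add m)) _ _)
      (fun x => encode_sigma x)).
Defined.

End PositiveDegree.

Theorem isequiv_sigma (G : U0) (setG : isset G) (add : G -> G -> G) (z : G) (neg : G -> G)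
  (addA : forall x y w, add x (add y w) = add (add x y) w)
  (addz : forall x, add x z = x) (addN : forall x, add x (neg x) = z)
  (addC : forall x y, add x y = add y x) (n : nat) : isequiv (sigma add z n).
Proof.
  nat_ind n.
  - exact (isequiv_sigma0 G setG add z neg addA addz addN addC).
  - exact (isequiv_sigma_pos G add z n (fst (multiplication add addC n))
      (snd (multiplication add addC n))).
Defined.

(** ** Reification *)

Ltac number n l :=
  lazymatch l with
  | (?c, ?l) => let l := number (S n) l in constr:((c, n, l))
  | tt => constr:(tt)
  end.

Ltac lookup t l :=
  lazymatch l with
  | (t, ?n, _) => n
  | (_, _, ?l) => lookup t l
  end.

Ltac position t vars :=
  lazymatch vars with
  | (t, _) => constr:(0)
  | (_, ?vars) => let n := position t vars in constr:(S n)
  end.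

(** A binder is entered by reifying the body in a context extended with a fresh
    variable, which then does not occur in the result. Globals are looked up in
    [tbl] and bound variables in [vars], both given as nested pairs. *)
Ltac reify tbl vars t :=
  lazymatch t with
  | forall x : ?A, @?B x =>
      let a := reify tbl vars A in
      let y := fresh in
      let b := constr:(fun y : A =>
        ltac:(let B' := eval cbv beta in (B y) in
              let r := reify tbl (y, vars) B' in exact r)) in
      lazymatch b with fun _ => ?b => constr:(sPi a b) end
  | fun x : ?A => @?f x =>
      let a := reify tbl vars A in
      let y := fresh in
      let b := constr:(fun y : A =>
        ltac:(let f' := eval cbv beta in (f y) in
              let r := reify tbl (y, vars) f' in exact r)) in
      lazymatch b with fun _ => ?b => constr:(sLam a b) end
  | let x : ?A := ?v in @?f x => 
      let y := fresh in
      let u := constr:((fun y : A => ltac:(let f' := eval cbv beta in (f y) in exact f')) v) in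
      reify tbl vars u
  | ?f ?x =>
      let a := reify tbl vars x in
      let g := reify tbl vars f in
      constr:(sApp g a)
  | U0 => constr:(sUniv 0)
  | U1 => constr:(sUniv 1)
  | U2 => constr:(sUniv 2)
  | @Id => constr:(sCst cId 2 2)
  | @refl => constr:(sCst cRefl 2 2)
  | @J => constr:(sCst cJ 2 2)
  | @Sig => constr:(sCst cSig 2 2)
  | @pair => constr:(sCst cPair 2 2)
  | @SigInd => constr:(sCst cSigInd 2 2)
  | nat => constr:(sCst cNat 2 2)
  | O => constr:(sCst cZero 2 2)
  | S => constr:(sCst cSuc 2 2)
  | NatInd => constr:(sCst cNatInd 2 2)
  | funext_isequiv => constr:(sCst cFunext 1 1)
  | ua_isequiv => constr:(sCst (cUa 0) 2 2)
  | @Susp => constr:(sCst cSusp 2 2)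
  | @north => constr:(sCst cNorth 2 2)
  | @south => constr:(sCst cSouth 2 2)
  | @merid => constr:(sCst cMerid 2 2)
  | @SuspInd => constr:(sCst cSuspInd 2 2)
  | @SuspIndMerid => constr:(sCst cSuspIndMerid 2 2)
  | @EM => constr:(sCst cEM 2 2)
  | @base => constr:(sCst cBase 2 2)
  | @loop => constr:(sCst cLoop 2 2)
  | @square => constr:(sCst cSquare 2 2)
  | @EMInd => constr:(sCst cEMInd 2 2)
  | @EMIndPaths => constr:(sCst cEMIndPaths 2 2)
  | @Tr => constr:(sCst cTr 2 2)
  | @tr => constr:(sCst cTrIn 2 2)
  | @tr_level => constr:(sCst cTrLevel 0 0)
  | @TrInd0 => constr:(sCst cTrInd 0 0)
  | @TrInd => constr:(sCst cTrInd 0 1)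
  | _ =>
      match constr:(0) with
      | _ => let n := position t vars in constr:(sVar n)
      | _ => let n := lookup t tbl in constr:(sGlob n)
      end
  end.

Ltac reify_program tbl l :=
  lazymatch l with
  | (?c, ?l) =>
      let T := type of c in
      let b := eval cbv delta [c] in c in
      let T := reify tbl tt T in
      let b := reify tbl tt b in
      let p := reify_program tbl l in
      constr:(Entry T b :: p)
  | tt => constr:(@nil entry)
  end.

(** The order is that of the definitions, since an entry may refer to earlier
    ones only. *)
Definition program : list entry :=
  ltac:(let l := constr:(
    (@concat, (@inv, (@ap, (@transport, (@IdOver, (@apd, (@concatOver, (@IdOver2,
    (@apd_concat, (@apd2, (@PJ, (@fst, (@snd, (@concat_p1, (@concat_Vp, (@concat_pV,
    (@ap_concat, (@transport_concat, (@transport_inv, (@transport_ap,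
    (@sig_path, (@isContr, (@istrunc, (@istrunc0, (@isprop, (@isset,
    (@istrunc_raise, (@contr_isprop, (@contr_path, (@trunc_succ, (@trunc_id,
    (@prop_trunc1, (@trunc1_prop, (@prop_trunc, (@set_trunc, (@trunc_set,
    (@prop_set, (@retract_path, (@trunc_retract, (@set_of_relation, (@path_sig,
    (@sig_path', (@sig_path_retract, (@trunc_sig_path, (@trunc_sig, (@isequiv,
    (@equiv, (@mk_isequiv, (@idequiv, (@idtoequiv, (@happly, (@EM_loops,
    (@EM_squares, (@funext, (@happly_funext, (@htpy_ind, (@trunc_pi,
    (@isprop_istrunc, (@ua, (@idtoequiv_ua, (@ua_idtoequiv, (@trunc_equiv,
    (@trunc_path_universe, (@NType, (@El, (@El_trunc, (@trunc_NType, (@ntype_path,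
    (@transport_universe, (@transport_El_sig_path, (@transport_ntype_path,
    (@contr_singleton, (@contr_isequiv_id, (@isprop_isequiv, (@ntype_equiv,
    (@ntype_equiv_transport, (@sig_path_refl, (@ntype_path_equiv,
    (@ntype_path_unique, (@constOver, (@constOver_inj, (@apd_const,
    (@concatOver_const, (@IdOver2_const, (@susp_rec, (@susp_rec_merid, (@em_rec,
    (@em_rec_loop, (@EM_ind_set, (@lev, (@rawK, (@rawK_pt, (@K, (@K_pt, (@LoopK,
    (@trK, (@ap_tr, (@northK, (@southK, (@meridK, (@rawK_ind, (@raw_sigma,
    (@LoopK_level, (@sigma, (@Tr_trunc, (@isequiv_homotopic, (@transport_loops,
    (@encode_decode, (@transport_code, (@concat_V_pp, (@idempotent_path,
    (@translation, (@G_ntype, (@translation_path, (@translation_path_add,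
    (@raw_code0, (@code0, (@transport_code0, (@sigma0_add, (@decode0,
    (@isequiv_sigma0, (@conn, (@pointed_path, (@isprop_extensions,
    (@isset_extensions, (@pointed_map, (@unit_map, (@isset_pointed_map,
    (@transport_pointed, (@conj_over, (@loops_commute, (@loop_homotopy,
    (@multiplication, (@sigma_coherence, (@sigma_coherence_diag, (@mul, (@mul_unit,
    (@isequiv_mul, (@K_ntype, (@mul_path, (@raw_code, (@code, (@transport_raw_code,
    (@tr_merid, (@hom_at, (@hom_at_pt, (@hom_extension, (@hom_extension_unit,
    (@sigma_hom, (@sigma_transport, (@decode, (@encode_sigma, (@isequiv_sigma_pos,
    (@isequiv_sigma,
    tt))))))))))))))))))))))))))))))))))))))))))))))))))))))))))))))))))))))))))))))
    ))))))))))))))))))))))))))))))))))))))))))))))))))))))))))))))))))))))))))))) in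
  let tbl := number 0 l in
  let p := reify_program tbl l in exact p).

End Primitives.
End HoTT.

Import Meta Checker Soundness.

(** * The theorem *)

Lemma isequiv_sigma_level0 :
  exists t : tm,
    typing nil t
      (close
         (forall_abgroup 0 (fun G add z =>
            Π n : Nat,
              isequiv (K 0 G add n) (LoopK 0 G add z n)
                (sigma 0 G add z n)))).
Proof.
  (* The number bounds the depth of the recursion in the checker. *)
  apply (proves_sound 1000 HoTT.program (sGlob (pred (length HoTT.program)))).
  vm_compute. reflexivity.
Qed.

Theorem theorem22 (i : nat) :
  exists t : tm,
    typing nil t
      (close
         (forall_abgroup i (fun G add z =>
            Π n : Nat,
              isequiv (K i G add n) (LoopK i G add z n)
                (sigma i G add z n)))).
Proof.
  destruct isequiv_sigma_level0 as [t Ht].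
  exists (raise i t). exact (typing_raise i _ _ _ Ht).
Qed.
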